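(* Let $(G,<)$ be a nontrivial ordered abelian group with natural valuation $v$. Then: (i) $(G,<)$ is symmetrically complete if and only if it is spherically complete w.r.t. its natural valuation $v$, its value set $vG$ is strongly symmetrically complete, and all archimedean components $\mathcal{C}_\gamma$, $\gamma\in vG$, are isomorphic to $\mathbb{R}$. (ii) $(G,<)$ is strongly symmetrically complete if and only if in addition to the three conditions in (i), $vG$ has uncountable cofinality. (iii) $(G,<)$ is extremely symmetrically complete if and only if in addition to the three conditions in (i), $vG$ is extremely symmetrically complete.
   Context: Ordered means linearly ordered. Natural valuation: $a,b\in G$ are archimedean equivalent if there is $n\in\mathbb{N}$ with $n|a|\ge|b|$ and $n|b|\ge|a|$; $va$ denotes the archimedean equivalence class of $a$. The classes are linearly ordered by: $va>vb$ iff $n|a|<|b|$ for all $n\in\mathbb{N}$; put $\infty:=v0$ (the maximal class). The value set is $vG=\{vg\mid 0\ne g\in G\}$. For $\gamma\in vG$ let $\mathcal{O}_\gamma=\{g\in G\mid vg\ge\gamma\}$, $\mathcal{M}_\gamma=\{g\in G\mid vg>\gamma\}$; the archimedean component is the archimedean ordered group $\mathcal{C}_\gamma=\mathcal{O}_\gamma/\mathcal{M}_\gamma$. ''Isomorphic to $\mathbb{R}$'' means as ordered groups. Ultrametric balls are the sets $B_u(a,b)=\{g\in G\mid v(a-g)\ge v(a-b)\}$, $a,b\in G$. $G$ is spherically complete w.r.t. its natural valuation if every nonempty chain (w.r.t. inclusion) of ultrametric balls has nonempty intersection. A cut in a linearly ordered set $I$ is a pair $(D,E)$ of nonempty subsets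 with $I=D\cup E$ and $d<e$ for all $d\in D$, $e\in E$. Its cofinality is $(\kappa,\lambda)$ with $\kappa=\mathrm{cf}(D)$ the cofinality of $D$ and $\lambda=\mathrm{ci}(E)$ the coinitiality of $E$ (cofinality under the reversed ordering); these equal $1$ when $D$ has a maximum, resp. $E$ has a minimum. The cut is asymmetric if $\kappa\ne\lambda$, and strongly asymmetric if moreover at least one of $\kappa,\lambda$ is uncountable. $I$ is symmetrically complete (strongly symmetrically complete) if every cut in $I$ is asymmetric (strongly asymmetric); it is extremely symmetrically complete if it is strongly symmetrically complete and both its coinitiality and cofinality are uncountable. An ordered abelian group has one of these properties if its underlying linearly ordered set does. *)

(* Defs.v *)
From HB Require Import structures.
From mathcomp Require Import all_boot all_order all_algebra.
From mathcomp Require Import generic_quotient ring_quotient.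
From mathcomp Require Import boolp classical_sets cardinality reals.

Set Implicit Arguments.
Unset Strict Implicit.
Unset Printing Implicit Defensive.

Import Order.TTheory GRing.Theory.

Local Open Scope classical_set_scope.
Local Open Scope card_scope.
Local Open Scope ring_scope.

Section Cofinality.
Context {d : Order.disp_t} {T : orderType d}.
Implicit Types D K L : set T.

Definition cofinal_in D K :=
  K `<=` D /\ forall x, D x -> exists2 y, K y & (x <= y)%O.

(* Cardinals are represented by sets up to [#=], so the cofinality of [D] is
   given by any cofinal subset [K] of [D] of least cardinality. *)
Definition has_cofinality D K :=
  cofinal_in D K /\ forall L, cofinal_in D L -> K #<= L.

Definition uncountable_cofinality D :=
  exists2 K, has_cofinality D K & ~ countable K.

End Cofinality.

Section Coinitiality.
Context {d : Order.disp_t} {T : orderType d}.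
Implicit Types E L : set T.

Definition has_coinitiality E L := @has_cofinality _ T^d E L.

Definition uncountable_coinitiality E := @uncountable_cofinality _ T^d E.

End Coinitiality.

Section Cuts.
Context {d : Order.disp_t} {T : orderType d}.
Implicit Types D E : set T.

Definition is_cut D E :=
  [/\ D !=set0, E !=set0, D `|` E = [set: T]
    & forall x y, D x -> E y -> (x < y)%O].

Definition asymmetric_cut D E :=
  exists K L, [/\ has_cofinality D K, has_coinitiality E L & ~ (K #= L)].

Definition strongly_asymmetric_cut D E :=
  asymmetric_cut D E /\
  (uncountable_cofinality D \/ uncountable_coinitiality E).

End Cuts.

Definition symmetrically_complete {d : Order.disp_t} (T : orderType d) :=
  forall D E : set T, is_cut D E -> asymmetric_cut D E.

Definition strongly_symmetrically_complete {d : Order.disp_t}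
    (T : orderType d) :=
  forall D E : set T, is_cut D E -> strongly_asymmetric_cut D E.

Definition extremely_symmetrically_complete {d : Order.disp_t}
    (T : orderType d) :=
  [/\ strongly_symmetrically_complete T,
      uncountable_coinitiality [set: T] & uncountable_cofinality [set: T]].

(* The totality of the order is part of the mixin, and the [orderType] instance
   is derived afterwards: a join of [zmodType] and [orderType] declared here
   would come after [realDomainType], which HB rejects. *)
HB.mixin Record isOrderedZmodule G of Num.POrderedZmodule G := {
  oz_le_total : total (<=%R : rel G);
  oz_leD2l_subproof : forall z x y : G, x <= y -> z + x <= z + y
}.

#[short(type="oZmodType")]
HB.structure Definition OrderedZmodule :=
  {G of isOrderedZmodule G & Num.POrderedZmodule G}.

HB.instance Definition _ (G : oZmodType) :=
  Order.POrder_isTotal.Build ring_display G oz_le_total.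

Definition ordered_group_isomorphic (A B : porderZmodType) :=
  exists f : {additive A -> B}, bijective f /\ {mono f : x y / x <= y}.

Definition oabs {G : oZmodType} (a : G) : G := Num.max a (- a).

Section OrderedZmoduleTheory.
Variable G : oZmodType.
Implicit Types a b c x y z : G.

Lemma oz_leD2l z x y : (z + x <= z + y) = (x <= y).
Proof.
apply/idP/idP => [/(oz_leD2l_subproof (- z))|]; last exact: oz_leD2l_subproof.
by rewrite !addKr.
Qed.

Lemma oz_leD2r z x y : (x + z <= y + z) = (x <= y).
Proof. by rewrite ![_ + z]addrC oz_leD2l. Qed.

Lemma oz_leD x y z t : x <= y -> z <= t -> x + z <= y + t.
Proof.
by move=> xy zt; apply: (@le_trans _ _ (y + z)); rewrite ?oz_leD2r ?oz_leD2l.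
Qed.

Lemma oz_oppr_ge0 x : (0 <= - x) = (x <= 0).
Proof. by rewrite -(oz_leD2r x 0 (- x)) add0r addNr. Qed.

Lemma oz_subr_ge0 x y : (0 <= y - x) = (x <= y).
Proof. by rewrite -(oz_leD2r x 0) add0r subrK. Qed.

Lemma oz_mulrn_ge0 x n : 0 <= x -> 0 <= x *+ n.
Proof.
move=> x0; elim: n => [|n IH]; first by rewrite mulr0n.
by rewrite mulrS -[0]addr0; apply: oz_leD.
Qed.

Lemma oz_ler_mulrn x y n : x <= y -> x *+ n <= y *+ n.
Proof.
move=> xy; elim: n => [|n IH]; first by rewrite !mulr0n.
by rewrite !mulrS; apply: oz_leD.
Qed.

Lemma oz_ler_mulrnl x m n : 0 <= x -> (m <= n)%N -> x *+ m <= x *+ n.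
Proof.
move=> x0 mn; rewrite -(subnK mn) mulrnDr -{1}[x *+ m]add0r oz_leD2r.
exact: oz_mulrn_ge0.
Qed.

Lemma oabsN a : oabs (- a) = oabs a.
Proof. by rewrite /oabs opprK maxC. Qed.

Lemma le_oabs a : a <= oabs a.
Proof. by rewrite /oabs le_max lexx. Qed.

Lemma oabs_ge0 a : 0 <= oabs a.
Proof.
by rewrite /oabs le_max oz_oppr_ge0; case/orP: (le_total (0 : G) a) => ->;
  rewrite ?orbT.
Qed.

Lemma oz_ltD2l z x y : (z + x < z + y) = (x < y).
Proof. by rewrite !lt_neqAle oz_leD2l (inj_eq (addrI z)). Qed.

Lemma ge0_oabs a : 0 <= a -> oabs a = a.
Proof.
move=> a0; rewrite /oabs max_l // (le_trans _ a0) //.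
by rewrite -oz_oppr_ge0 opprK.
Qed.

Lemma oabs0 : oabs (0 : G) = 0.
Proof. by rewrite /oabs oppr0 maxxx. Qed.

Lemma oabs_le0 a : (oabs a <= 0) = (a == 0).
Proof.
apply/idP/eqP => [|->]; last by rewrite oabs0.
rewrite /oabs ge_max -(oz_leD2r a (- a)) addNr add0r => /andP[a0 a0'].
by apply/le_anti; rewrite a0.
Qed.

Lemma oabsD a b : oabs (a + b) <= oabs a + oabs b.
Proof.
have h (x y : G) : x + y <= oabs x + oabs y by rewrite oz_leD ?le_oabs.
by rewrite [oabs (a + b)]/oabs ge_max h opprD -(oabsN a) -(oabsN b) h.
Qed.

End OrderedZmoduleTheory.

Section ArchimedeanClasses.
Variable G : oZmodType.
Implicit Types a b c : G.

Definition arch_equiv : rel G := fun a b =>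
  `[< exists n : nat, oabs b <= oabs a *+ n /\ oabs a <= oabs b *+ n >].

(* [va > vb] *)
Definition arch_small : rel G := fun a b =>
  `[< forall n : nat, oabs a *+ n < oabs b >].

Lemma arch_smallPn a b :
  reflect (exists n : nat, oabs b <= oabs a *+ n) (~~ arch_small a b).
Proof.
apply: (iffP idP) => [/asboolPn/existsNP[n /negP]|[n bn]].
  by rewrite -leNgt; exists n.
by apply/asboolP => /(_ n); rewrite ltNge bn.
Qed.

Lemma arch_equivE a b : arch_equiv a b = ~~ arch_small a b && ~~ arch_small b a.
Proof.
apply/asboolP/andP => [[n [ba ab]]|[/arch_smallPn[n ba] /arch_smallPn[m ab]]].
  by split; apply/arch_smallPn; exists n.
exists (maxn n m); split.
  by apply: (le_trans ba); rewrite oz_ler_mulrnl ?oabs_ge0 ?leq_maxl.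
by apply: (le_trans ab); rewrite oz_ler_mulrnl ?oabs_ge0 ?leq_maxr.
Qed.

Lemma arch_nsmall_trans : transitive (fun a b => ~~ arch_small a b).
Proof.
move=> b a c /arch_smallPn[n ba] /arch_smallPn[m cb]; apply/arch_smallPn.
by exists (n * m)%N; rewrite mulrnA (le_trans cb) // oz_ler_mulrn.
Qed.

Lemma arch_small_asym a b : arch_small a b -> ~~ arch_small b a.
Proof.
move=> /asboolP ab; apply/negP => /asboolP ba.
by have := lt_trans (ab 1%N) (ba 1%N); rewrite !mulr1n ltxx.
Qed.

Lemma arch_small_irr a : ~~ arch_small a a.
Proof. by apply/arch_smallPn; exists 1%N; rewrite mulr1n. Qed.

Lemma arch_equiv_is_equiv : equiv_class_of arch_equiv.
Proof.
split=> [a|a b|b a c]; rewrite !arch_equivE ?arch_small_irr //.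
  by rewrite andbC.
move=> /andP[ab ba] /andP[bc cb].
by apply/andP; split; [exact: arch_nsmall_trans bc|exact: arch_nsmall_trans ba].
Qed.

Canonical arch_equiv_equiv := EquivRelPack arch_equiv_is_equiv.
Canonical arch_equiv_encModRel := defaultEncModRel arch_equiv.

Definition arch_class := {eq_quot arch_equiv}%qT.
HB.instance Definition _ := EqQuotient.on arch_class.
HB.instance Definition _ := Choice.on arch_class.

Definition natval (a : G) : arch_class := (\pi_arch_class a)%qT.

Definition arch_class_lt : rel arch_class :=
  fun x y => arch_small (repr y) (repr x).

Lemma natvalP a b : reflect (natval a = natval b) (arch_equiv a b).
Proof.
by apply: (iffP idP) => [ab|/eqmodP]; [apply/eqmodP|].
Qed.

Lemma arch_class_lt_natval a b :
  arch_class_lt (natval a) (natval b) = arch_small b a.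
Proof.
have e c : arch_equiv (repr (natval c)) c by apply/natvalP; rewrite /natval reprK.
rewrite /arch_class_lt; apply: negb_inj.
move: (e a) (e b); rewrite !arch_equivE.
set a' := repr _; set b' := repr _ => /andP[a'a aa'] /andP[b'b bb'].
apply/idP/idP => h.
  exact: arch_nsmall_trans (arch_nsmall_trans bb' h) a'a.
exact: arch_nsmall_trans (arch_nsmall_trans b'b h) aa'.
Qed.

Lemma arch_class_lt_irr : irreflexive arch_class_lt.
Proof. by move=> x; apply: negbTE; exact: arch_small_irr. Qed.

Lemma arch_class_lt_trans : transitive arch_class_lt.
Proof.
move=> y x z; rewrite /arch_class_lt.
move: (repr x) (repr y) (repr z) => a b c ba cb.
apply: contraT => ca; move: (arch_nsmall_trans ca (arch_small_asym ba)).
by rewrite cb.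
Qed.

Fact arch_class_display : Order.disp_t. Proof. exact: Order.Disp tt tt. Qed.

HB.instance Definition _ := Order.Lt_isPOrder.Build arch_class_display
  arch_class arch_class_lt_irr arch_class_lt_trans.

Lemma natval_lt a b :
  (natval b < natval a)%O = `[< forall n : nat, oabs a *+ n < oabs b >].
Proof. exact: arch_class_lt_natval. Qed.

Lemma arch_class_le_total : total (<=%O : rel arch_class).
Proof.
move=> x y; rewrite -(reprK x) -(reprK y) !le_eqVlt.
rewrite -![(\pi _)%qT]/(natval _) !natval_lt.
set a := repr x; set b := repr y.
have [ab|] := boolP (arch_equiv a b).
  by rewrite (natvalP _ _ ab) eqxx.
rewrite arch_equivE negb_and !negbK => /orP[] h.
  by rewrite [`[< _ >] in X in _ || X]h !orbT.
by rewrite [`[< _ >] in X in X || _]h orbT.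
Qed.

HB.instance Definition _ := Order.POrder_isTotal.Build arch_class_display
  arch_class arch_class_le_total.

Lemma natval_le a b :
  (natval a <= natval b)%O = `[< exists n : nat, oabs b <= oabs a *+ n >].
Proof.
rewrite leNgt natval_lt.
by apply/idP/asboolP => /arch_smallPn.
Qed.

Lemma natvalN a : natval (- a) = natval a.
Proof.
by apply/natvalP/asboolP; exists 1%N; rewrite oabsN mulr1n lexx.
Qed.

Lemma natval_le0 a : (natval a <= natval 0)%O.
Proof.
by rewrite natval_le; apply/asboolP; exists 0%N; rewrite oabs0 mulr0n.
Qed.

Lemma natvalD x a b :
  (x <= natval a)%O -> (x <= natval b)%O -> (x <= natval (a + b))%O.
Proof.
rewrite -(reprK x) -[(\pi _)%qT]/(natval _) !natval_le.
move=> /asboolP[n an] /asboolP[m bm]; apply/asboolP; exists (n + m)%N.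
by rewrite mulrnDr (le_trans (oabsD _ _)) // oz_leD.
Qed.

Lemma natval_ltD x a b :
  (x < natval a)%O -> (x < natval b)%O -> (x < natval (a + b))%O.
Proof.
move=> xa xb; have [ab|/ltW ba] := leP (natval a) (natval b).
  by apply: (lt_le_trans xa); apply: natvalD.
by apply: (lt_le_trans xb); apply: natvalD.
Qed.

End ArchimedeanClasses.

Section ValueSet.
Variable G : oZmodType.

Record value_set := ValueSet {
  value_val : arch_class G;
  _ : `[< exists2 g : G, g != 0 & natval g = value_val >]
}.

HB.instance Definition _ := [isSub for value_val].
HB.instance Definition _ := [Choice of value_set by <:].
HB.instance Definition _ :=
  [SubChoice_isSubOrder of value_set by <: with arch_class_display].

End ValueSet.

Definition ultraball {G : oZmodType} (a b : G) : set G :=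
  [set g | (natval (a - b) <= natval (a - g))%O].

Definition spherically_complete (G : oZmodType) :=
  forall C : set (set G),
    C !=set0 ->
    (forall B, C B -> exists a b : G, B = ultraball a b) ->
    total_on C subset ->
    \bigcap_(B in C) B !=set0.

Section ArchimedeanComponent.
Variables (G : oZmodType) (gamma : value_set G).

Definition O_pred : {pred G} := fun g => (value_val gamma <= natval g)%O.

Lemma O_pred_zmod : zmod_closed O_pred.
Proof.
split=> [|a b]; rewrite !unfold_in.
  by apply: le_trans (natval_le0 (repr (value_val gamma))); rewrite /natval reprK.
by move=> ha hb; apply: natvalD => //; rewrite natvalN.
Qed.
HB.instance Definition _ := GRing.isZmodClosed.Build G O_pred O_pred_zmod.

Record O_group := OGroup { O_val : G; _ : O_val \in O_pred }.

HB.instance Definition _ := [isSub for O_val].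
HB.instance Definition _ := [Choice of O_group by <:].
HB.instance Definition _ := [SubChoice_isSubZmodule of O_group by <:].

(* [M_gamma] is given as a subgroup of [O_gamma]; the elements of [G] of value
   [> gamma] all belong to [O_gamma]. *)
Definition M_pred : {pred O_group} :=
  fun g => (value_val gamma < natval (O_val g))%O.

Lemma M_pred_zmod : zmod_closed M_pred.
Proof.
split=> [|a b]; rewrite !unfold_in.
  have -> : O_val (0 : O_group) = 0 by [].
  case: gamma => x /= /asboolP[g g0 <-].
  rewrite natval_lt; apply/asboolP => n.
  by rewrite oabs0 mul0rn ltNge oabs_le0.
have -> : O_val (a - b) = O_val a - O_val b by [].
by move=> ha hb; apply: natval_ltD => //; rewrite natvalN.
Qed.
HB.instance Definition _ := GRing.isZmodClosed.Build O_group M_pred M_pred_zmod.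

Definition arch_component := Quotient.quot M_pred.
HB.instance Definition _ := GRing.Zmodule.on arch_component.
HB.instance Definition _ := EqQuotient.on arch_component.

Definition residue (a : O_group) : arch_component := (\pi_arch_component a)%qT.

(* This compares arbitrary representatives; that it is the order induced from
   [G], independently of their choice, is [residue_lt] below. *)
Definition component_lt : rel arch_component :=
  fun x y => O_val (repr x) < O_val (repr y).

Lemma component_lt_irr : irreflexive component_lt.
Proof. by move=> x; rewrite /component_lt ltxx. Qed.

Lemma component_lt_trans : transitive component_lt.
Proof. by move=> y x z; exact: lt_trans. Qed.

HB.instance Definition _ := Order.Lt_isPOrder.Build ring_display
  arch_component component_lt_irr component_lt_trans.

Lemma residueP a b : reflect (residue a = residue b) (a - b \in M_pred).
Proof. by rewrite Quotient.idealrBE; exact: eqP. Qed.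

Lemma residueD a b : residue (a + b) = residue a + residue b.
Proof. exact: raddfD. Qed.

Lemma M_pred_lt a b a' b' :
  a' - a \in M_pred -> b' - b \in M_pred -> a - b \notin M_pred ->
  O_val a < O_val b -> O_val a' < O_val b'.
Proof.
move=> a'a b'b ab lt_ab.
have : (b' - b) - (a' - a) \in M_pred by rewrite rpredB.
have : b - a \notin M_pred by rewrite -opprB rpredN.
rewrite !unfold_in -leNgt.
have -> : O_val (b' - b - (a' - a)) =
   O_val b' - O_val b - (O_val a' - O_val a) by [].
have -> : O_val (b - a) = O_val b - O_val a by [].
move: (O_val a) (O_val b) (O_val a') (O_val b') lt_ab => x y x' y' xy.
move=> /le_lt_trans h /h; rewrite natval_lt => /asboolP/(_ 1%N).
rewrite mulr1n [oabs (y - x)]ge0_oabs ?oz_subr_ge0 ?(ltW xy)// => lt1.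
rewrite ltNge; apply/negP => y'x'; move: lt1; apply/negP; rewrite -leNgt.
rewrite -oabsN; apply: le_trans (le_oabs _).
have -> : - (y' - y - (x' - x)) = (y - x) + (x' - y').
  by rewrite !opprB addrC addrACA [RHS]addrC [RHS]addrACA [x' + y]addrC.
by rewrite -[X in X <= _]addr0 oz_leD2l oz_subr_ge0.
Qed.

Lemma residue_lt a b :
  (residue a < residue b) = (residue a != residue b) && (O_val a < O_val b).
Proof.
have h c : repr (residue c) - c \in M_pred.
  by apply/residueP; rewrite /residue reprK.
have [e|/eqP ne] := eqVneq (residue a) (residue b); first by rewrite e ltxx.
rewrite -[LHS]/(O_val (repr (residue a)) < O_val (repr (residue b))).
apply/idP/idP; apply: M_pred_lt.
- by rewrite -opprB rpredN.
- by rewrite -opprB rpredN.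
- by apply/residueP; rewrite /residue !reprK.
- exact: h.
- exact: h.
- exact/residueP.
Qed.

Lemma residue_le a b : O_val a <= O_val b -> residue a <= residue b.
Proof.
rewrite !le_eqVlt => /orP[/eqP/val_inj->|ab]; first by rewrite eqxx.
by case: eqVneq => //= ne; rewrite residue_lt ne.
Qed.

Lemma component_le_total : total (<=%R : rel arch_component).
Proof.
move=> x y; rewrite -(reprK x) -(reprK y) -![(\pi _)%qT]/(residue _).
by case/orP: (le_total (O_val (repr x)) (O_val (repr y))) => /residue_le ->;
  rewrite ?orbT.
Qed.

Lemma component_leD2l (z x y : arch_component) : x <= y -> z + x <= z + y.
Proof.
rewrite le_eqVlt => /predU1P[-> //|].
rewrite -(reprK x) -(reprK y) -(reprK z) -![(\pi _)%qT]/(residue _).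
rewrite residue_lt => /andP[_ /ltW xy].
by rewrite -!residueD residue_le // oz_leD2l.
Qed.

HB.instance Definition _ := isOrderedZmodule.Build arch_component
  component_le_total component_leD2l.

End ArchimedeanComponent.

(* Main.v *)
(* A map between linear orders whose values eventually exceed any given element of
   the target forces equal cofinalities as soon as the target has no maximum, so
   cofinalities are compared by exhibiting such maps.

   A cut (I, J) of the value set vG induces the cut of G whose upper side is
   { g > c | v(g - c) in I }; its cofinality is (max(ci J, w), max(cf I, w)) once
   all components are copies of R. Hence it is asymmetric exactly when (I, J) is
   strongly asymmetric. This explains the condition on vG.

   In a symmetrically complete group, a nest of balls with empty intersection, or
   a real number missed by a component dense in R, would give a symmetric cut, and
   so would the reflection x |-> p - x if a component had a least positive element
   p. Conversely, given a cut (D, E), the values v(e - d) form an initial segment;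
   completeness of the component of its maximum, or spherical completeness if it
   has none, gives a point c next to which the cut, or its reflection, is induced
   by a cut of vG as above. *)
From HB Require Import structures.
Require Import Defs.
From mathcomp Require Import all_boot all_order all_algebra.
From mathcomp Require Import boolp classical_sets functions cardinality reals.
From mathcomp Require Import lra.

Set Implicit Arguments.
Unset Strict Implicit.
Unset Printing Implicit Defensive.

Import Order.TTheory GRing.Theory Num.Theory.
Local Open Scope classical_set_scope.
Local Open Scope card_scope.
Local Open Scope ring_scope.

(* Zorn: a maximal set of choice functions with pairwise injective coordinates
   must have a surjective coordinate. *)
Lemma min_card_exists {T : Type} (F : set (set T)) :
  F !=set0 -> exists2 A, F A & forall B, F B -> A #<= B.
Proof.
move=> [A0 FA0].
(* An empty member of [F] is minimal at once. Otherwise every member can be avoided or hit pointwise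
   by choice functions on [F]. *)
have [ne|/existsNP[A /not_implyP[FA /set0P/negP/negPn/eqP A0E]]] :=
  pselect (forall A, F A -> A !=set0); last first.
  by exists A => // B _; rewrite A0E card_ge0.
pose P (X : set (set T -> T)) :=
  (forall x A, X x -> F A -> A (x A)) /\
  (forall x y A, X x -> X y -> F A -> x A = y A -> x = y).
have [C CP totC|X [[XA Xinj] Xmax]] := @Zorn_bigcup _ P.
  split=> [x A [Y CY Yx]|x y A [Y CY Yx] [Z CZ Zy] FA].
    by case: (CP _ CY) => + _; apply.
  have [YZ|ZY] := totC _ _ CY CZ.
    by case: (CP _ CZ) => _; apply=> //; apply: YZ.
  by case: (CP _ CY) => _; apply=> //; apply: ZY.
(* If the coordinate at [A] is onto, then [A] is an image of [X], and [X] injects into each [B] by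
   its coordinate at [B]. *)
have [[A [FA surjA]]|nsurj] := pselect (exists A, F A /\
    forall a, A a -> exists2 x, X x & x A = a).
  exists A => // B FB.
  apply: (@card_le_trans _ _ _ X).
    apply: (@card_le_trans _ _ _ [set x A | x in X]); last exact: card_image_le.
    by apply: subset_card_le => a /surjA[x Xx xA]; exists x.
  have /injfunPex[f] : exists2 f : (set T -> T) -> T, set_fun X B f & set_inj X f.
    exists (fun x => x B) => [x /= Xx|x y /set_mem Xx /set_mem Xy]; first exact: (XA x B).
    exact: Xinj Xx Xy FB.
  exact: inj_card_le.
have [y yP] : exists y : set T -> T,
    forall A, F A -> A (y A) /\ forall x, X x -> x A <> y A.
  have [t0 _] := ne _ FA0.
  suff /choice[y] : forall A, exists a, F A -> A a /\ forall x, X x -> x A <> a.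
    by exists y.
  move=> A; have [FA|nFA] := pselect (F A); last by exists t0.
  apply: contrapT => /forallNP H; apply: nsurj; exists A; split=> // a Aa.
  apply: contrapT => /forall2NP H2; apply: (H a) => _; split=> // x Xx xA.
  by have [] := H2 x.
exfalso; apply: (Xmax (X `|` [set y])).
  split=> [|XyX]; first by move=> x; left.
  have Xy : X y by apply: XyX; right.
  by case: (yP _ FA0) => _ /(_ _ Xy).
split=> [x A [Xx|->] FA|x z A [Xx|->] [Xz|->] FA //]; first exact: (XA x A).
- by case: (yP _ FA).
- exact: Xinj Xx Xz FA.
- by case: (yP _ FA) => _ /(_ _ Xx).
- by move=> e; case: (yP _ FA) => _ /(_ _ Xz); rewrite e.
Qed.

(** * Cofinalities *)

Section CofinalityTheory.
Context {d : Order.disp_t} {T : orderType d}.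
Implicit Types D K : set T.

Definition no_max D := forall x, D x -> exists2 y, D y & (x < y)%O.

Definition countable_cofinality D := exists2 K, cofinal_in D K & countable K.

Lemma cofinality_exists D : exists K, has_cofinality D K.
Proof.
have [|K KD Kmin] := @min_card_exists _ (cofinal_in D).
  by exists D; split=> // x Dx; exists x.
by exists K.
Qed.

(** A cofinal subset of least cardinality exists and injects into any countable cofinal subset, so
    countability can be tested on any cofinal subset. *)
Lemma uncountable_cofinalityP D :
  uncountable_cofinality D <-> ~ countable_cofinality D.
Proof.
split=> [[K [_ Kmin] nK] [L DL cL]|nD].
  by apply: nK; apply: sub_countable (Kmin _ DL) cL.
have [K HK] := cofinality_exists D.
by exists K => // cK; apply: nD; exists K => //; case: HK.
Qed.

Lemma has_cofinality_countable D K :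
  has_cofinality D K -> countable_cofinality D <-> countable K.
Proof.
move=> [DK Kmin]; split=> [[L DL cL]|cK]; last by exists K.
exact: sub_countable (Kmin _ DL) cL.
Qed.

Lemma has_cofinality_uncountable D K :
  has_cofinality D K -> uncountable_cofinality D <-> ~ countable K.
Proof.
move=> DK; rewrite uncountable_cofinalityP.
by split; apply: contra_not; rewrite (has_cofinality_countable DK).
Qed.

Lemma finite_set_upper_bound D K :
  D !=set0 -> K `<=` D -> finite_set K ->
  exists2 m, D m & forall x, K x -> (x <= m)%O.
Proof.
move=> [x0 Dx0] KD /finite_seqP[s sE]; rewrite sE in KD *.
elim: s KD {sE} => [|a s IH] KD; first by exists x0.
have [x xs|m Dm mP] := IH; first by apply: KD; rewrite /= inE xs orbT.
have Da : D a by apply: KD; rewrite /= inE eqxx.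
exists (Order.max m a) => [|x /=]; first by case: (leP m a).
rewrite inE le_max => /predU1P[->|/mP ->] //.
by rewrite lexx orbT.
Qed.

Lemma cofinal_infinite D K :
  D !=set0 -> no_max D -> cofinal_in D K -> infinite_set K.
Proof.
move=> D0 Dmax [KD Kcof] finK.
have [m Dm mP] := finite_set_upper_bound D0 KD finK.
have [y Dy my] := Dmax _ Dm; have [z Kz yz] := Kcof _ Dy.
by have := lt_le_trans my (le_trans yz (mP _ Kz)); rewrite ltxx.
Qed.

Lemma has_cofinality_max D K m :
  has_cofinality D K -> D m -> (forall x, D x -> (x <= m)%O) -> finite_set K.
Proof.
move=> [_ Kmin] Dm mP.
have /Kmin : cofinal_in D [set m].
  by split=> [x ->|x Dx] //; exists m => //; apply: mP.
by move=> h; apply: card_le_finite h (finite_set1 m).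
Qed.

Lemma no_maxPn D : ~ no_max D -> exists2 m, D m & forall x, D x -> (x <= m)%O.
Proof.
move=> /existsNP[m /not_implyP[Dm /forall2NP mP]]; exists m => // x Dx.
by rewrite leNgt; apply/negP => mx; case: (mP x).
Qed.

Lemma has_cofinality_infinite D K :
  D !=set0 -> has_cofinality D K -> infinite_set K <-> no_max D.
Proof.
move=> D0 DK; split=> [infK|Dmax]; last exact: cofinal_infinite D0 Dmax DK.1.
apply: contrapT => /no_maxPn[m Dm mP]; apply: infK.
exact: has_cofinality_max DK Dm mP.
Qed.

End CofinalityTheory.

(** * Comparison of cofinalities along convergent maps *)

Section CofinalMaps.
Context {d1 d2 : Order.disp_t} {T1 : orderType d1} {T2 : orderType d2}.
Implicit Types (D K : set T1) (E L : set T2).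

(* For linear orders without maximum such a map forces the cofinalities to be
   equal; unlike a monotone cofinal map, it can be chosen pointwise. *)
Definition convergent_map D E (f : T1 -> T2) :=
  (forall x, D x -> E (f x)) /\
  forall y, E y -> exists2 x, D x & forall z, D z -> (x <= z)%O -> (y <= f z)%O.

Lemma convergent_map_le D E f K L :
  convergent_map D E f -> has_cofinality D K -> has_cofinality E L -> L #<= K.
Proof.
move=> [fDE fcvg] [[KD Kcof] _] [_ Lmin].
apply: card_le_trans (card_image_le f K); apply: Lmin.
split=> [_ [x Kx <-]|y /fcvg[x /Kcof[z Kz xz] xP]]; first exact/fDE/KD.
by exists (f z); [exists z|apply: xP => //; apply: KD].
Qed.

Lemma convergent_map_eq D E f K L :
  convergent_map D E f -> no_max E -> has_cofinality D K ->
  has_cofinality E L -> K #= L.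
Proof.
move=> fP Emax DK EL; rewrite card_eq_le (convergent_map_le fP DK EL) andbT.
case: fP => fDE fcvg; case: DK => [_ Kmin]; case: EL => [[LE Lcof] _].
(* The choice of thresholds [g] below needs a default point, so empty [D] is settled first. *)
have [D0|/set0P[x0 Dx0]] := eqVneq D set0.
  have /card_le_trans : K #<= @set0 T1 by apply: Kmin; rewrite D0; split.
  by apply; apply: card_ge0.
have /choice[g gP] : forall y, exists x, E y ->
    D x /\ forall z, D z -> (x <= z)%O -> (y <= f z)%O.
  move=> y; have [Ey|] := pselect (E y); last by exists x0.
  by have [x Dx xP] := fcvg _ Ey; exists x.
apply: card_le_trans (card_image_le g L); apply: Kmin.
split=> [_ [y /LE/gP[Dgy _] <-] //|x Dx].
(* If the thresholds of [L] are not cofinal, some [x] lies beyond all of them, so [f x] bounds [L].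
   This contradicts the element [y] of [E] above [f x]. *)
apply: contrapT => /forall2NP xP.
have [y Ey xy] := Emax _ (fDE _ Dx); have [z Lz yz] := Lcof _ Ey.
have [|/negP] := xP (g z); first by case; exists z.
rewrite -ltNge => gzx; have [_ /(_ _ Dx (ltW gzx))] := gP _ (LE _ Lz).
by move=> /(le_trans yz)/(lt_le_trans xy); rewrite ltxx.
Qed.

Lemma countable_cofinality_eq D E K L :
  D !=set0 -> no_max D -> countable_cofinality D ->
  E !=set0 -> no_max E -> countable_cofinality E ->
  has_cofinality D K -> has_cofinality E L -> K #= L.
Proof.
move=> D0 Dmax cD E0 Emax cE DK EL.
have cK : countable K by apply/(has_cofinality_countable DK).
have cL : countable L by apply/(has_cofinality_countable EL).
have infK : infinite_set K by apply/(has_cofinality_infinite D0 DK).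
have infL : infinite_set L by apply/(has_cofinality_infinite E0 EL).
apply: card_eq_trans (eq_card_nat cK infK) _.
by rewrite card_eq_sym; exact: eq_card_nat.
Qed.

End CofinalMaps.

Lemma countable_cofinality_seq {d} {T : orderType d} (D : set T) (u : nat -> T) :
  (forall n, D (u n)) -> (forall x, D x -> exists n, (x <= u n)%O) ->
  countable_cofinality D.
Proof.
move=> Du ucof; exists (range u).
  split=> [_ [n _ <-] //|x /ucof[n xn]]; by exists (u n) => //; exists n.
exact: sub_countable (card_image_le _ _) (card_lexx _).
Qed.

Lemma has_cofinality_card_unique {d} {T : orderType d} (D K L : set T) :
  has_cofinality D K -> has_cofinality D L -> K #= L.
Proof.
by move=> [DK Kmin] [DL Lmin]; rewrite card_eq_le Kmin // Lmin.
Qed.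

(** Minimal cofinal subsets are unique up to bijection, so any chosen pair decides asymmetry. *)
Lemma asymmetric_cutP {d} {T : orderType d} (D E K L : set T) :
  has_cofinality D K -> has_coinitiality E L ->
  asymmetric_cut D E <-> ~ (K #= L).
Proof.
move=> DK EL; split=> [[K' [L' [DK' EL' neq]]] eq|neq]; last by exists K, L.
apply: neq; apply: card_eq_trans (has_cofinality_card_unique DK' DK) _.
exact: card_eq_trans eq (has_cofinality_card_unique EL EL').
Qed.

(** * Ordered abelian groups *)

Section OrderedZmodule.
Variable G : oZmodType.
Implicit Types a b c x y z g : G.

Lemma oz_ltD2r z x y : (x + z < y + z) = (x < y).
Proof. by rewrite ![_ + z]addrC oz_ltD2l. Qed.

Lemma oz_subr_gt0 x y : (0 < y - x) = (x < y).
Proof. by rewrite -(oz_ltD2r x 0) add0r subrK. Qed.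

Lemma oz_lerBlDl x y z : (x - y <= z) = (x <= y + z).
Proof. by rewrite -(oz_leD2l y (x - y)) addrC subrK. Qed.

Lemma oz_ltrBrDl x y z : (z < x - y) = (y + z < x).
Proof. by rewrite -(oz_ltD2l y z) [y + (_ - _)]addrC subrK. Qed.

Lemma oz_lerBrDl x y z : (z <= x - y) = (y + z <= x).
Proof. by rewrite -(oz_leD2l y z) [y + (_ - _)]addrC subrK. Qed.

Lemma oz_ltN2 x y : (- x < - y) = (y < x).
Proof. by rewrite -[LHS]oz_subr_gt0 opprK addrC oz_subr_gt0. Qed.

Lemma oz_leN2 x y : (- x <= - y) = (y <= x).
Proof. by rewrite -[LHS]oz_subr_ge0 opprK addrC oz_subr_ge0. Qed.

Lemma oz_ltDl x y : (x < x + y) = (0 < y).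
Proof. by rewrite -{1}[x]addr0 oz_ltD2l. Qed.

Lemma oz_leB2l z x y : (z - x <= z - y) = (y <= x).
Proof. by rewrite oz_leD2l oz_leN2. Qed.

Lemma oz_ltB2l z x y : (z - x < z - y) = (y < x).
Proof. by rewrite oz_ltD2l oz_ltN2. Qed.

Lemma natvalB a b : natval (a - b) = natval (b - a).
Proof. by rewrite -natvalN opprB. Qed.

Lemma natval_ge a b : 0 <= b -> b <= a -> (natval a <= natval b)%O.
Proof.
move=> b0 ba; rewrite natval_le; apply/asboolP; exists 1%N.
by rewrite mulr1n !ge0_oabs // (le_trans b0).
Qed.

Lemma natval_lt_lt a b : 0 <= b -> (natval b < natval a)%O -> a < b.
Proof.
move=> b0; rewrite natval_lt => /asboolP/(_ 1%N); rewrite mulr1n (ge0_oabs b0).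
exact/le_lt_trans/le_oabs.
Qed.

Lemma natval_le_mulrn a b :
  0 <= b -> (natval b <= natval a)%O -> exists n, a <= b *+ n.
Proof.
move=> b0; rewrite natval_le => /asboolP[n]; rewrite (ge0_oabs b0) => ab.
by exists n; apply: le_trans (le_oabs a) ab.
Qed.

Lemma natval_mulrn a n : (natval a <= natval (a *+ n))%O.
Proof.
elim: n => [|n IH]; first by rewrite mulr0n natval_le0.
by rewrite mulrS natvalD.
Qed.

(** The elements of value at least [u] form a convex set: according to its sign, [x] is dominated in
    absolute value by [z] or by [y]. *)
Lemma natval_between x y z u :
  y <= x -> x <= z -> (u <= natval y)%O -> (u <= natval z)%O ->
  (u <= natval x)%O.
Proof.
move=> yx xz uy uz; have [x0|/ltW x0] := leP (0 : G) x.
  exact/(le_trans uz)/natval_ge.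
apply: (le_trans uy); rewrite -natvalN -(natvalN x); apply: natval_ge.
  by rewrite oz_oppr_ge0.
by rewrite oz_leN2.
Qed.

Lemma value_set_posrep (gamma : value_set G) :
  exists2 a, 0 < a & natval a = value_val gamma.
Proof.
case: gamma => u /= /asboolP[g g0 <-]; exists (oabs g).
  by rewrite lt_neqAle oabs_ge0 andbT eq_sym eq_le oabs_ge0 andbT oabs_le0.
by rewrite /oabs; case: (leP g (- g)) => _ //; rewrite natvalN.
Qed.

Lemma natval_value_set a : a != 0 -> exists gamma, value_val gamma = natval a.
Proof.
move=> a0; have H : `[< exists2 g : G, g != 0 & natval g = natval a >].
  by apply/asboolP; exists a.
by exists (ValueSet H).
Qed.

Lemma natval_pos_value_set a : 0 < a -> exists gamma, value_val gamma = natval a.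
Proof. by move=> a0; apply: natval_value_set; rewrite gt_eqF. Qed.

Lemma value_set_le (gamma delta : value_set G) :
  (gamma <= delta)%O = (value_val gamma <= value_val delta)%O.
Proof. exact: leEsub. Qed.

Lemma value_set_lt (gamma delta : value_set G) :
  (gamma < delta)%O = (value_val gamma < value_val delta)%O.
Proof. exact: ltEsub. Qed.

Lemma value_set_lt0 (gamma : value_set G) :
  (value_val gamma < natval (0 : G))%O.
Proof.
have [a a0 <-] := value_set_posrep gamma.
by rewrite natval_lt; apply/asboolP => n; rewrite oabs0 mul0rn ge0_oabs // ltW.
Qed.

End OrderedZmodule.

(** * Cofinalities of the cuts of the group induced by cuts of the value set *)

Section Cuts.
Variable G : oZmodType.
Variable c : G.
Implicit Types (I J : set (value_set G)).

(* [lower_part J] and [upper_part I] are the two sides of the cut of [G] next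
   to [c] induced by a cut [(I, J)] of the value set. *)
Definition lower_part J : set G := [set g | g <= c \/
  exists2 gamma, J gamma & (value_val gamma <= natval (g - c)%R)%O].

Definition upper_part I : set G := [set g | c < g /\
  exists2 gamma, I gamma & (natval (g - c)%R <= value_val gamma)%O].

Lemma posrep_exists : exists p : value_set G -> G,
  forall gamma, 0 < p gamma /\ natval (p gamma) = value_val gamma.
Proof.
suff /choice[p pP] : forall gamma : value_set G, exists a : G,
    0 < a /\ natval a = value_val gamma by exists p.
by move=> gamma; have [a a0 aE] := value_set_posrep gamma; exists a.
Qed.

Let pos := sval (cid posrep_exists).
Let pos_gt0 gamma : 0 < pos gamma. Proof. exact: (svalP (cid posrep_exists) gamma).1. Qed.
Let posE gamma : natval (pos gamma) = value_val gamma.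
Proof. exact: (svalP (cid posrep_exists) gamma).2. Qed.

Lemma lower_part_neq0 J : lower_part J !=set0.
Proof. by exists c; left. Qed.

Lemma lower_part_no_max J : J !=set0 -> no_max (lower_part J).
Proof.
move=> [gamma0 J0] g [gc|[gamma Jg gg]].
  exists (c + pos gamma0); last by rewrite (le_lt_trans gc) // oz_ltDl.
  by right; exists gamma0; rewrite // addrC addKr posE.
exists (g + pos gamma); last by rewrite oz_ltDl.
by right; exists gamma => //; rewrite addrAC natvalD // posE.
Qed.

(** Going down in [J] makes [c + pos gamma] grow, since a smaller value dominates a larger one;
    hence the dual order on the source. *)
Lemma lower_part_convergent J : no_max (T := (value_set G)^d) J -> J !=set0 ->
  convergent_map (T1 := (value_set G)^d) J (lower_part J) (fun gamma => c + pos gamma).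
Proof.
move=> Jmin [gamma0 J0]; split=> [gamma Jg|g [gc|[gamma Jg gg]]].
- by right; exists gamma; rewrite // addrC addKr posE.
- exists gamma0 => // gamma _ _.
  by rewrite (le_trans gc) // ltW // oz_ltDl.
have [gamma1 J1 lt1] := Jmin _ Jg; exists gamma1 => // delta Jd d1.
rewrite -oz_lerBlDl ltW // natval_lt_lt ?(ltW (pos_gt0 _)) // posE.
apply: lt_le_trans gg; rewrite -value_set_lt.
by move: d1 lt1; rewrite leEdual ltEdual; exact: le_lt_trans.
Qed.

(** The multiples of one positive element of least value [m] are cofinal, by the archimedean
    property within a class. *)
Lemma lower_part_countable J m : J m -> (forall gamma, J gamma -> (m <= gamma)%O) ->
  countable_cofinality (lower_part J).
Proof.
move=> Jm mP; apply: (@countable_cofinality_seq _ _ _ (fun n => c + pos m *+ n)).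
  move=> n; right; exists m => //; rewrite [c + _]addrC addrK -posE.
  exact: natval_mulrn.
move=> g [gc|[gamma Jg gg]]; first by exists 0%N; rewrite mulr0n addr0.
have [|n nP] := @natval_le_mulrn _ (g - c) _ (ltW (pos_gt0 m)).
  by rewrite posE (le_trans _ gg) // -value_set_le mP.
by exists n; rewrite -oz_lerBlDl.
Qed.

(** The three clauses together say that the cofinality of the lower side is the maximum of
    aleph-zero and the coinitiality of [J]. *)
Lemma lower_part_cofinality J L K : J !=set0 ->
  has_coinitiality J L -> has_cofinality (lower_part J) K ->
  [/\ infinite_set K, infinite_set L -> K #= L & countable L -> countable K].
Proof.
move=> J0 JL PK; have nmax := lower_part_no_max J0.
have infL : infinite_set L -> K #= L.
  move=> infL; rewrite card_eq_sym.
  have Jmin : no_max (T := (value_set G)^d) J.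
    exact/(has_cofinality_infinite (T := (value_set G)^d) J0 JL).
  exact: convergent_map_eq (lower_part_convergent Jmin J0) nmax JL PK.
split=> //; first by apply/(has_cofinality_infinite _ PK) => //; apply: lower_part_neq0.
move=> cL; have [finL|/infL KL] := pselect (finite_set L); last first.
  by apply: sub_countable cL; move: KL; rewrite card_eq_le => /andP[].
apply/(has_cofinality_countable PK).
have /no_maxPn[m Jm mP] : ~ no_max (T := (value_set G)^d) J.
  by move=> /(has_cofinality_infinite (T := (value_set G)^d) J0 JL); apply.
exact: lower_part_countable Jm mP.
Qed.

(** This says that the positive part of the component has coinitiality aleph-zero, phrased in [G]
    rather than in the quotient. It is what the upper side of an induced cut requires when [I] has a
    maximum. *)
Definition dense_component (gamma : value_set G) :=
  exists u : nat -> G, (forall n, 0 < u n /\ natval (u n) = value_val gamma) /\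
    forall g, 0 < g -> (natval g <= value_val gamma)%O -> exists n, u n < g.

Lemma upper_part_neq0 I : I !=set0 -> upper_part I !=set0.
Proof.
move=> [gamma Ig]; exists (c + pos gamma); split; first by rewrite oz_ltDl.
by exists gamma; rewrite // addrC addKr posE.
Qed.

Lemma upper_part_convergent I : no_max I ->
  convergent_map (T2 := G^d) I (upper_part I) (fun gamma => c + pos gamma).
Proof.
move=> Imax; split=> [gamma Ig|g [cg [gamma Ig gg]]].
  split; first by rewrite oz_ltDl.
  by exists gamma; rewrite // addrC addKr posE.
have [gamma1 I1 lt1] := Imax _ Ig; exists gamma1 => // delta Id d1.
rewrite leEdual -oz_lerBrDl ltW // natval_lt_lt ?oz_subr_ge0 ?(ltW cg) //.
by rewrite posE (le_lt_trans gg) // -value_set_lt (lt_le_trans lt1).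
Qed.

Lemma upper_part_seq I m : dense_component m -> I m ->
  (forall gamma, I gamma -> (gamma <= m)%O) ->
  exists u : nat -> G, (forall n, upper_part I (u n)) /\
    forall g, upper_part I g -> exists n, u n < g.
Proof.
move=> [u [uP ucof]] Im mP; exists (fun n => c + u n); split=> [n|g [cg [gamma Ig gg]]].
  have [u0 uE] := uP n; split; first by rewrite oz_ltDl.
  by exists m; rewrite // addrC addKr uE.
have [||n nP] := ucof (g - c); first by rewrite oz_subr_gt0.
  by rewrite (le_trans gg) // -value_set_le mP.
by exists n; rewrite -oz_ltrBrDl.
Qed.

Lemma upper_part_no_min I : (forall gamma, dense_component gamma) ->
  no_max (T := G^d) (upper_part I).
Proof.
move=> dense; have [Imax|/no_maxPn[m Im mP]] := pselect (no_max I).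
  move=> g [cg [gamma Ig gg]]; have [delta Id gd] := Imax _ Ig.
  have [fI] := upper_part_convergent Imax.
  exists (c + pos delta); first exact: fI.
  rewrite ltEdual -oz_ltrBrDl natval_lt_lt ?oz_subr_ge0 ?(ltW cg) //.
  by rewrite posE (le_lt_trans gg).
have [u [uP ucof]] := upper_part_seq (dense m) Im mP.
by move=> g /ucof[n nP]; exists (u n).
Qed.

(** The clauses again express a maximum with aleph-zero. If [I] has a maximum, the sequence of
    [dense_component] replaces the multiples used for the lower side. *)
Lemma upper_part_coinitiality I L K : (forall gamma, dense_component gamma) ->
  I !=set0 -> has_cofinality I L -> has_coinitiality (upper_part I) K ->
  [/\ infinite_set K, infinite_set L -> K #= L & countable L -> countable K].
Proof.
move=> dense I0 IL PK; have nmax := upper_part_no_min (I := I) dense.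
have infL : infinite_set L -> K #= L.
  move=> infL; rewrite card_eq_sym.
  have Imax : no_max I by apply/(has_cofinality_infinite I0 IL).
  exact: convergent_map_eq (upper_part_convergent Imax) nmax IL PK.
split=> //.
  by apply/(has_cofinality_infinite _ PK) => //; apply: upper_part_neq0.
move=> cL; have [finL|/infL KL] := pselect (finite_set L); last first.
  by apply: sub_countable cL; move: KL; rewrite card_eq_le => /andP[].
apply/(has_cofinality_countable PK).
have /no_maxPn[m Im mP] : ~ no_max I.
  by move=> /(has_cofinality_infinite I0 IL); apply.
have [u [uP ucof]] := upper_part_seq (dense m) Im mP.
apply: (@countable_cofinality_seq _ G^d _ u) => // g /ucof[n nP].
by exists n; rewrite leEdual ltW.
Qed.

End Cuts.

(** With [K'] and [L'] standing for the maxima of [K] and [L] with aleph-zero, two such maxima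
    differ exactly when the original cardinals differ and one of them is uncountable. *)
Lemma card_eq_max_aleph0 {T1 T2 T3 T4 : Type} (K : set T1) (L : set T2)
    (K' : set T3) (L' : set T4) :
  infinite_set K' -> (infinite_set K -> K' #= K) -> (countable K -> countable K') ->
  infinite_set L' -> (infinite_set L -> L' #= L) -> (countable L -> countable L') ->
  ~ (K' #= L') <-> ~ (K #= L) /\ (~ countable K \/ ~ countable L).
Proof.
move=> infK' eqK cK infL' eqL cL.
have inf_unc (T : Type) (A : set T) : ~ countable A -> infinite_set A.
  by apply: contra_not; exact: finite_set_countable.
have unc (S T : Type) (A : set S) (B : set T) : A #= B -> countable B -> countable A.
  by move=> AB cB; rewrite (eq_countable AB).
split=> [neq|[neq [/[dup] uK /inf_unc/eqK e|/[dup] uL /inf_unc/eqL e]] eq].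
- have unc2 : ~ countable K \/ ~ countable L.
    apply/not_andP => -[/cK cK' /cL cL']; apply: neq.
    apply: card_eq_trans (eq_card_nat cK' infK') _.
    by rewrite card_eq_sym; exact: eq_card_nat.
  split=> // eq; apply: neq.
  have [infK infL] : infinite_set K /\ infinite_set L.
    have fin_eq : finite_set K = finite_set L by apply: eq_finite_set.
    by rewrite -fin_eq; case: unc2 => /inf_unc; rewrite -?fin_eq.
  apply: card_eq_trans (eqK infK) (card_eq_trans eq _).
  by rewrite card_eq_sym; exact: eqL.
- apply: neq; apply: card_eq_trans (card_eq_trans eq (eqL _)).
    by rewrite card_eq_sym.
  apply/inf_unc => /cL/(unc _ _ _ _ eq)/(unc _ _ _ _ _) cK'.
  by apply: uK; apply: cK'; rewrite card_eq_sym.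
- apply: neq; rewrite card_eq_sym; apply: card_eq_trans (card_eq_trans _ (eqK _)).
    by rewrite card_eq_sym; exact: e.
  by rewrite card_eq_sym.
  apply/inf_unc => /cK; rewrite card_eq_sym in eq => /(unc _ _ _ _ eq).
  by move=> cL'; apply: uL; apply: unc cL'; rewrite card_eq_sym.
Qed.

Section StandardCut.
Variable G : oZmodType.
Hypothesis dense : forall gamma : value_set G, dense_component gamma.

Lemma asymmetric_lower_upper (c : G) (I J : set (value_set G)) :
  I !=set0 -> J !=set0 ->
  asymmetric_cut (lower_part c J) (upper_part c I) <-> strongly_asymmetric_cut I J.
Proof.
move=> I0 J0.
have [K IK] := cofinality_exists I.
have [L JL] := @cofinality_exists _ (value_set G)^d J.
have [L' PL] := cofinality_exists (lower_part c J).
have [K' QK] := @cofinality_exists _ G^d (upper_part c I).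
have [infL' eqL cL] := lower_part_cofinality J0 JL PL.
have [infK' eqK cK] := upper_part_coinitiality dense I0 IK QK.
rewrite (asymmetric_cutP PL QK) /strongly_asymmetric_cut (asymmetric_cutP IK JL).
rewrite (has_cofinality_uncountable IK) /uncountable_coinitiality.
rewrite (has_cofinality_uncountable JL).
rewrite -(card_eq_max_aleph0 infK' eqK cK infL' eqL cL).
by rewrite card_eq_sym.
Qed.

(** Here [c] is the maximum of the lower side, whose cofinality is thus finite, while the upper side
    has no minimum and so infinite coinitiality. *)
Lemma asymmetric_lower_upper0 (c : G) (I J : set (value_set G)) :
  I !=set0 -> J = set0 -> asymmetric_cut (lower_part c J) (upper_part c I).
Proof.
move=> I0 J0.
have [L' PL] := cofinality_exists (lower_part c J).
have [K' QK] := @cofinality_exists _ G^d (upper_part c I).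
apply/(asymmetric_cutP PL QK) => eq.
have : infinite_set K'.
  apply/(has_cofinality_infinite _ QK); last exact: upper_part_no_min dense.
  exact: upper_part_neq0.
apply; rewrite -(eq_finite_set eq); apply: (has_cofinality_max (m := c) PL).
  by left.
by move=> g [//|[gamma]]; rewrite J0.
Qed.

End StandardCut.

Lemma inv_succ_lt {R : realType} (e : R) : 0 < e -> exists n : nat, n.+1%:R^-1 < e.
Proof.
move=> e0; exists (Num.truncn e^-1).
by rewrite invf_plt ?posrE ?ltr0Sn // truncnS_gt.
Qed.

(** * Hölder's embedding theorem *)

Section Holder.
Variables (R : realType) (A : oZmodType) (a : A).
Hypothesis a_gt0 : 0 < a.
Hypothesis archimedean : forall x y : A, 0 < x -> exists n, y <= x *+ n.

Lemma oz_mulrz_le (m k : int) : (a *~ m <= a *~ k) = (m <= k).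
Proof.
have le1 (i j : int) : i <= j -> a *~ i <= a *~ j.
  rewrite -subr_ge0 -[a *~ i <= _]oz_subr_ge0 -mulrzBr; case: (j - i) => // n _.
  exact/oz_mulrn_ge0/ltW.
apply/idP/idP => [|/le1//]; apply: contraTT; rewrite -!ltNge => km.
have /le1 : k + 1 <= m by rewrite -ltzD1 ltrD2r.
by apply: lt_le_trans; rewrite mulrzDr oz_ltDl.
Qed.

Lemma oz_floor (z : A) : exists m : int, a *~ m <= z /\ z <= a *~ (m + 1).
Proof.
(* Adding [a *+ k] makes [z] nonnegative, so the least bounding multiple can be sought among natural
   numbers. *)
have [k zk] := archimedean (- z) a_gt0.
have [|n nP nmin] := @ex_minnP (fun n => z + a *+ k <= a *+ n).
  by have [n] := archimedean (z + a *+ k) a_gt0; exists n.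
exists (n%:Z - 1 - k%:Z); split; last first.
  by rewrite addrAC subrK mulrzBr -!pmulrn oz_lerBrDl addrC.
rewrite !mulrzBr -!pmulrn !oz_lerBlDl mulr1n [_ + z]addrC.
(* For [n = 0] minimality says nothing, and nonnegativity of [z + a *+ k] is used instead. *)
case: n nP nmin => [|n] _ nmin.
  rewrite mulr0n -[0]addr0 oz_leD ?(ltW a_gt0) //.
  by rewrite -oz_lerBlDl sub0r.
rewrite mulrS oz_leD2l leNgt; apply/negP => /ltW/nmin.
by rewrite ltnn.
Qed.

(** These are the rationals not exceeding the ratio of [x] to the unit [a]; writing the denominator
    as [n.+1] keeps it nonzero. *)
Definition holder_set (x : A) : set R := [set q |
  exists (m : int) (n : nat), q = m%:~R / n.+1%:R /\ a *~ m <= x *+ n.+1].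

Definition holder (x : A) : R := sup (holder_set x).

Lemma holder_set_ub x (m : int) (n : nat) : x *+ n.+1 <= a *~ m ->
  ubound (holder_set x) (m%:~R / n.+1%:R).
Proof.
move=> xa _ [m' [n' [-> xa']]].
rewrite ler_pdivrMr ?ltr0Sn // mulrAC ler_pdivlMr ?ltr0Sn //.
rewrite -[n.+1%:R]/(n.+1%:~R) -[n'.+1%:R]/(n'.+1%:~R) -!intrM ler_int.
rewrite -oz_mulrz_le !mulrzA -!pmulrn.
apply: le_trans (oz_ler_mulrn n.+1 xa') _.
by rewrite -mulrnA mulnC mulrnA oz_ler_mulrn.
Qed.

Lemma holder_set_neq0 x : holder_set x !=set0.
Proof.
have [m [mx _]] := oz_floor x; exists (m%:~R / 1%:R); exists m, 0%N.
by rewrite mulr1n.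
Qed.

Lemma holder_le x (m : int) (n : nat) :
  x *+ n.+1 <= a *~ m -> holder x <= m%:~R / n.+1%:R.
Proof. by move=> /holder_set_ub; apply/ge_sup/holder_set_neq0. Qed.

Lemma holder_ge x (m : int) (n : nat) :
  a *~ m <= x *+ n.+1 -> m%:~R / n.+1%:R <= holder x.
Proof.
move=> ax; apply: ub_le_sup; last by exists m, n.
have [k [_ xk]] := oz_floor x.
by exists ((k + 1)%:~R / 1%:R); apply: holder_set_ub; rewrite mulr1n.
Qed.

(** Rounding [x] and [y] down to multiples of [a] at denominator [n.+1] puts both sides in one
    interval of length twice [n.+1%:R^-1], which is eventually shorter than any gap between them. *)
Lemma holderD x y : holder (x + y) = holder x + holder y.
Proof.
apply/eqP; rewrite -subr_eq0 -normr_le0 leNgt; apply/negP => gap.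
have [n nP] : exists n : nat, n.+1%:R^-1 < `|holder (x + y) - (holder x + holder y)| / 2.
  by apply: inv_succ_lt; rewrite divr_gt0.
have [m [mx xm]] := oz_floor (x *+ n.+1).
have [k [ky yk]] := oz_floor (y *+ n.+1).
have /holder_ge : a *~ (m + k) <= (x + y) *+ n.+1.
  by rewrite mulrzDr mulrnDl oz_leD.
have /holder_le : (x + y) *+ n.+1 <= a *~ ((m + 1) + (k + 1)).
  by rewrite [a *~ _]mulrzDr mulrnDl oz_leD.
move: (holder_ge mx) (holder_le xm) (holder_ge ky) (holder_le yk).
rewrite !intrD !mulrDl !mul1r; move: nP.
move: (n.+1%:R^-1) (m%:~R / _) (k%:~R / _) => e p q.
by rewrite ltr_pdivlMr // lter_normr; case/orP; lra.
Qed.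

Lemma holder_ge0 x : 0 <= x -> 0 <= holder x.
Proof.
move=> x0; suff : (0 : int)%:~R / 1%:R <= holder x by rewrite mul0r.
by apply: holder_ge; rewrite mulr0z mulr1n.
Qed.

Lemma holder_gt0 x : 0 < x -> 0 < holder x.
Proof.
move=> x0; have [[|n] nP] := archimedean a x0.
  by move: a_gt0; rewrite ltNge; rewrite mulr0n in nP; rewrite nP.
apply: lt_le_trans (_ : (1 : int)%:~R / n.+1%:R <= _).
  by rewrite divr_gt0 // ltr0Sn.
by apply: holder_ge; rewrite mulr1z.
Qed.

Lemma holderB : zmod_morphism holder.
Proof.
have holder0 : holder 0 = 0 by apply: (addrI (holder 0)); rewrite -holderD !addr0.
move=> x y; apply: (addIr (holder y)); rewrite -holderD !subrK.
by [].
Qed.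

Lemma holder_mono : {mono holder : x y / x <= y}.
Proof.
move=> x y; rewrite -subr_ge0 -holderB -oz_subr_ge0.
apply/idP/idP; last exact: holder_ge0.
apply: contraTT; rewrite -!ltNge -oz_ltN2 oppr0 => /holder_gt0.
rewrite -oppr_gt0; congr (0 < _).
by apply/eqP; rewrite -addr_eq0 -holderD addNr -[0](subrr 0) holderB subrr.
Qed.

Lemma holder_embedding : exists f : {additive A -> R}, {mono f : x y / x <= y}.
Proof.
pose h := GRing.isZmodMorphism.Build A R holder holderB.
pose f : {additive A -> R} := HB.pack holder h.
by exists f; exact: holder_mono.
Qed.

End Holder.

(** * Archimedean components *)

Section ComponentMap.
Variables (R : realType) (G : oZmodType) (gamma : value_set G).
Implicit Types (x y : G) (psi : G -> R).

(** An order embedding of the component into [R], pulled back to [G]: an additive map on the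
    elements of value at least [gamma] with kernel those of value above it. Values elsewhere are
    arbitrary, which spares the cut arguments the quotient. *)
Definition component_map psi := [/\
  forall x y, (value_val gamma <= natval x)%O -> (value_val gamma <= natval y)%O ->
    psi (x + y) = psi x + psi y,
  forall x, (value_val gamma <= natval x)%O -> 0 <= x -> 0 <= psi x
  & forall x, (value_val gamma <= natval x)%O ->
    psi x = 0 <-> (value_val gamma < natval x)%O].

Definition component_onto psi :=
  forall r, exists2 x, (value_val gamma <= natval x)%O & psi x = r.

Lemma residue_surj (z : arch_component gamma) : exists a, z = residue a.
Proof. by exists (repr z); rewrite /residue reprK. Qed.

Lemma residue_eq0 (a : O_group gamma) :
  residue a = 0 <-> (value_val gamma < natval (O_val a))%O.
Proof.
have -> : 0 = residue (0 : O_group gamma) by rewrite /residue raddf0.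
split=> [/residueP|h]; first by rewrite subr0.
by apply/residueP; rewrite subr0.
Qed.

(** Elements of value below [gamma] are sent to the default 0. *)
Let lift x : O_group gamma := insubd 0 x.

Let liftK x : (value_val gamma <= natval x)%O -> O_val (lift x) = x.
Proof. by move=> Ox; rewrite -[LHS]/(\val (lift x)) insubdK. Qed.

Lemma additive_component_map (f : {additive arch_component gamma -> R}) :
  {mono f : x y / x <= y} -> component_map (fun x => f (residue (lift x))).
Proof.
move=> fmono; split=> [x y Ox Oy|x Ox x0|x Ox].
- rewrite -raddfD -residueD; congr (f (residue _)); apply: val_inj.
  change (O_val (lift (x + y)) = O_val (lift x) + O_val (lift y)).
  by rewrite !liftK // natvalD.
- rewrite -(raddf0 f) fmono.
  have -> : 0 = residue (0 : O_group gamma) by rewrite /residue raddf0.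
  by apply: residue_le; rewrite liftK.
rewrite -[in X in _ <-> X](liftK Ox) -residue_eq0; split=> [|->]; last exact: raddf0.
by rewrite -(raddf0 f) => /(inc_inj fmono).
Qed.

Lemma isomorphic_component_map : ordered_group_isomorphic (arch_component gamma) R ->
  exists2 psi, component_map psi & component_onto psi.
Proof.
move=> [f [[g fK gK] fmono]]; exists (fun x => f (residue (lift x))).
  exact: additive_component_map.
move=> r; have [a aE] := residue_surj (g r).
have Oa : (value_val gamma <= natval (O_val a))%O by case: a {aE}.
exists (O_val a) => //; rewrite -[RHS]gK aE; congr (f (residue _)).
by apply: val_inj; exact: liftK.
Qed.

Lemma component_archimedean (x y : arch_component gamma) :
  0 < x -> exists n, y <= x *+ n.
Proof.
have [a ->] := residue_surj x; have [b ->] := residue_surj y.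
have r0 : residue (0 : O_group gamma) = 0 by rewrite /residue raddf0.
rewrite -r0 residue_lt => /andP[+ a0]; rewrite r0 eq_sym => /eqP/residue_eq0/negP.
rewrite -leNgt => va.
have Ob : (value_val gamma <= natval (O_val b))%O by case: b.
have [n bn] := natval_le_mulrn (ltW a0) (le_trans va Ob).
exists n; rewrite -[residue a *+ n](raddfMn (\pi_(arch_component gamma))%qT).
apply: residue_le; apply: le_trans bn _; rewrite le_eqVlt; apply/orP; left.
by apply/eqP; elim: n => [|n IH]; rewrite ?mulr0n // !mulrS IH.
Qed.

(** The embedding of Hölder exists for every component; the second clause recovers the isomorphism
    once the pulled back map is known to be onto. *)
Lemma component_map_exists : exists psi, component_map psi /\
  (component_onto psi -> ordered_group_isomorphic (arch_component gamma) R).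
Proof.
have [c c0 cE] := value_set_posrep gamma.
have Oc : (value_val gamma <= natval c)%O by rewrite cE.
have rc : 0 < residue (lift c).
  have r0 : residue (0 : O_group gamma) = 0 by rewrite /residue raddf0.
  rewrite -r0 residue_lt r0 liftK // c0 andbT eq_sym.
  by apply/eqP => /residue_eq0; rewrite liftK // cE ltxx.
have [f fmono] := holder_embedding R rc component_archimedean.
exists (fun x => f (residue (lift x))); split; first exact: additive_component_map.
move=> onto; exists f; split=> //.
have finv r : exists z, f z = r by have [x _ <-] := onto r; exists (residue (lift x)).
have /choice[g gK] := finv; exists g => // z; apply: (inc_inj fmono).
by rewrite gK.
Qed.

End ComponentMap.

(** * Order and kernel of a component map *)

Section ComponentMapTheory.
Variables (R : realType) (G : oZmodType) (gamma : value_set G) (psi : G -> R).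
Hypothesis psiP : component_map gamma psi.
Implicit Types x y : G.

Local Notation O x := (value_val gamma <= natval x)%O.

Lemma component_map0 : psi 0 = 0.
Proof.
case: psiP => _ _ /(_ 0) psi0; apply/psi0; last exact: value_set_lt0.
exact/ltW/value_set_lt0.
Qed.

Lemma component_mapB x y : O x -> O y -> psi (x - y) = psi x - psi y.
Proof.
move=> Ox Oy; case: psiP => psiD _ _; apply: (addIr (psi y)).
by rewrite subrK -psiD ?subrK // natvalD // natvalN.
Qed.

Lemma component_map_le x y : O x -> O y -> x <= y -> psi x <= psi y.
Proof.
move=> Ox Oy xy; rewrite -subr_ge0 -component_mapB //.
case: psiP => _ psi0 _; apply: psi0; first by rewrite natvalD // natvalN.
by rewrite oz_subr_ge0.
Qed.

Lemma component_map_lt x y : O x -> O y -> psi x < psi y -> x < y.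
Proof.
move=> Ox Oy; apply: contraTT; rewrite -!leNgt; exact: component_map_le.
Qed.

Lemma component_map_eq x y : O x -> O y -> psi x = psi y ->
  (value_val gamma < natval (x - y))%O.
Proof.
move=> Ox Oy e; case: psiP => _ _ psi0; apply/psi0.
  by rewrite natvalD // natvalN.
by rewrite component_mapB // e subrr.
Qed.

Lemma component_map_gt0 x : 0 < x -> natval x = value_val gamma -> 0 < psi x.
Proof.
move=> x0 vx; case: psiP => _ psi_ge0 psi0; rewrite lt_neqAle psi_ge0 ?vx ?(ltW x0) //.
rewrite andbT eq_sym; apply/eqP => /psi0; rewrite vx ltxx.
by move/(_ (lexx _)).
Qed.

Lemma component_mapMz x (m : int) : O x -> psi (x *~ m) = psi x *~ m.
Proof.
move=> Ox; case: psiP => psiD _ _.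
have psiMn n : psi (x *+ n) = psi x *+ n.
  elim: n => [|n IH]; first by rewrite !mulr0n component_map0.
  by rewrite !mulrS psiD ?IH // (le_trans Ox) // natval_mulrn.
case: m => n; first exact: psiMn.
rewrite NegzE !mulrNz -!pmulrn -sub0r component_mapB ?component_map0 ?sub0r ?psiMn //.
  exact/ltW/value_set_lt0.
by rewrite (le_trans Ox) // natval_mulrn.
Qed.

Lemma component_map_positive x : O x -> 0 < psi x ->
  0 < x /\ natval x = value_val gamma.
Proof.
move=> Ox px; split.
  apply: component_map_lt => //; last by rewrite component_map0.
  exact/ltW/value_set_lt0.
apply/eqP; rewrite eq_le Ox andbT leNgt; apply/negP.
by case: psiP => _ _ /(_ _ Ox) <-; move: px; rewrite lt_def => /andP[/eqP].
Qed.

(** Preimages of [n.+1%:R^-1] give the sequence. An element of value below [gamma] exceeds all of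
    them, and one of value [gamma] has a positive image. *)
Lemma component_onto_dense : component_onto gamma psi -> dense_component gamma.
Proof.
move=> onto.
have /choice[u uP] : forall n : nat, exists x, O x /\ psi x = n.+1%:R^-1.
  by move=> n; have [x Ox xE] := onto n.+1%:R^-1; exists x.
exists u; split=> [n|g g0 gg].
  by have [Ou uE] := uP n; apply: component_map_positive; rewrite // uE invr_gt0 ltr0Sn.
have [lt|nlt] := boolP (natval g < value_val gamma)%O.
  exists 0%N; apply: natval_lt_lt (ltW g0) _; apply: lt_le_trans lt _.
  by case: (uP 0%N).
have {}vg : natval g = value_val gamma by apply/eqP; rewrite eq_le gg leNgt.
have [n nP] := inv_succ_lt (component_map_gt0 g0 vg); exists n.
have [Ou uE] := uP n.
by apply: component_map_lt; rewrite // ?vg // uE.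
Qed.

End ComponentMapTheory.

Lemma is_cutI {d} {T : orderType d} (D E : set T) :
  D !=set0 -> E !=set0 -> (forall x, D x \/ E x) ->
  (forall x y, D x -> E y -> (x < y)%O) -> is_cut D E.
Proof.
move=> D0 E0 DE lt; split=> //; apply/seteqP; split=> // x _; exact: DE.
Qed.

(** * Symmetrically complete groups *)

Section SymmetricallyComplete.
Variables (R : realType) (G : oZmodType).
Hypothesis Gsym : symmetrically_complete G.

Section Component.
Variables (gamma : value_set G) (psi : G -> R).
Hypothesis psiP : component_map gamma psi.

Local Notation O x := (value_val gamma <= natval x)%O.

(* The reflection [x |-> p - x] exchanges the two sides of the cut above the
   elements of value [> gamma]. *)
Lemma component_map_no_least p : O p -> 0 < psi p ->
  exists2 x, O x & 0 < psi x < psi p.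
Proof.
move=> Op pp; apply: contrapT => /forall2NP nx.
(* Under the negated claim, [psi p] is the least positive image. *)
have least x : O x -> 0 < psi x -> psi p <= psi x.
  move=> Ox px; rewrite leNgt; apply/negP => xp.
  by case: (nx x) => [/(_ Ox)//|]; rewrite px xp => /(_ isT).
have [p0 vp] := component_map_positive psiP Op pp.
pose D : set G := [set x | x <= 0 \/ (value_val gamma < natval x)%O].
pose E : set G := [set x | 0 < x /\ (natval x <= value_val gamma)%O].
have DE x y : D x -> E y -> x < y.
  move=> [x0|vx] [y0 vy]; first exact: le_lt_trans x0 y0.
  exact: natval_lt_lt (ltW y0) (le_lt_trans vy vx).
have Ep : E p by rewrite /E /= p0 vp.
have cutDE : is_cut D E.
  apply: is_cutI => //; [by exists 0; left|by exists p|move=> x].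
  have [x0|x0] := leP x (0 : G); first by left; left.
  by have [vx|vx] := leP (natval x) (value_val gamma); [right|left; right].
have DpE x : D x -> E (p - x).
  move=> Dx; split; first by rewrite oz_subr_gt0; apply: DE.
  case: Dx => [x0|vx]; first rewrite -vp.
    by apply: natval_ge; rewrite ?(ltW p0) // oz_lerBrDl -[X in _ <= X]add0r oz_leD2r.
  rewrite leNgt; apply/negP => /natval_ltD/(_ vx).
  by rewrite subrK vp ltxx.
(* If [y] is below [p], leastness forces [psi y = psi p], so [p - y] has value above [gamma]. *)
have EpD y : E y -> D (p - y).
  move=> [y0 vy]; have [py|py] := leP p y.
    by left; rewrite oz_lerBlDl addr0.
  right; have vyp : (natval p <= natval y)%O := natval_ge (ltW y0) (ltW py).
  have vy' : natval y = value_val gamma by apply/eqP; rewrite eq_le vy -vp.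
  have Oy : O y by rewrite vy'.
  apply: (component_map_eq psiP) => //; apply/eqP; rewrite eq_le.
  rewrite least ?(component_map_gt0 psiP) //=.
  by apply: (component_map_le psiP Oy Op); exact: ltW.
have [K [L [DK EL []]]] := Gsym cutDE.
(* The reflection is a convergent map in either direction, so each cofinality bounds the other,
   against asymmetry. *)
rewrite card_eq_le; apply/andP; split.
  apply: (@convergent_map_le _ _ G^d G E D (fun x => p - x) L K) => //.
  split=> // x Dx; exists (p - x); first exact: DpE.
  by move=> z Ez; rewrite leEdual oz_lerBrDl oz_lerBrDl addrC.
apply: (@convergent_map_le _ _ G G^d D E (fun x => p - x) K L) => //.
split=> // y Ey; exists (p - y); first exact: EpD.
by move=> z Dz; rewrite leEdual !oz_lerBlDl addrC.
Qed.

(** Given [y] with image strictly between 0 and that of [x], one of [y] and [x - y] has at most half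
    the image of [x]; iteration yields arbitrarily small images. *)
Lemma component_map_small e : 0 < e -> exists2 x, O x & 0 < psi x < e.
Proof.
move=> e0.
have [c c0 vc] := value_set_posrep gamma.
have Oc : O c by rewrite vc.
have pc : 0 < psi c := component_map_gt0 psiP c0 vc.
have small n : exists2 x, O x & 0 < psi x <= psi c / n.+1%:R.
  elim: n => [|n [x Ox /andP[x0 xn]]]; first by exists c; rewrite // pc divr1 lexx.
  have [y Oy /andP[y0 yx]] := component_map_no_least Ox x0.
  have half : psi x / 2 <= psi c / n.+2%:R.
    rewrite ler_pdivrMr // (le_trans xn) // -mulrA ler_pM2l //.
    rewrite mulrC ler_pdivlMr ?ltr0Sn // ler_pdivrMl ?ltr0Sn //.
    by rewrite -natrM ler_nat ltn_Pmulr.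
  have [yx2|yx2] := leP (psi y) (psi x / 2).
    by exists y; rewrite // y0 (le_trans yx2).
  have Oxy : O (x - y) by rewrite natvalD // natvalN.
  exists (x - y) => //; rewrite (component_mapB psiP) // subr_gt0 yx.
  by apply: le_trans half; lra.
have [n nP] := @inv_succ_lt R (e / psi c) (divr_gt0 e0 pc).
have [x Ox /andP[x0 xn]] := small n; exists x => //; rewrite x0 (le_lt_trans xn) //.
by rewrite mulrC -ltr_pdivlMr.
Qed.

Lemma component_map_dense s t : s < t -> exists2 x, O x & s < psi x < t.
Proof.
move=> st; have ts : 0 < t - s by rewrite subr_gt0.
have [p Op /andP[p0 pst]] := component_map_small ts.
(* This is the first multiple of [p] whose image exceeds [s]; it overshoots by at most [psi p],
   which is less than [t - s]. *)
exists (p *~ (Num.floor (s / psi p) + 1)).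
  by case: (_ + 1) => n; rewrite ?NegzE ?mulrNz ?natvalN (le_trans Op) // natval_mulrn.
rewrite (component_mapMz psiP) // -mulrzl.
have := floor_le (s / psi p); have := floorD1_gt (s / psi p).
rewrite ltr_pdivrMr // ler_pdivlMr // intrD => -> /=.
by move: (_%:~R) => q h; rewrite mulrDl mul1r; lra.
Qed.

(** By density, a missed real [r] is approached by sequences of images from both sides, and the cut
    at [r] would have both cofinalities aleph-zero. *)
Lemma symmetrically_complete_component : component_onto gamma psi.
Proof.
move=> r; apply: contrapT => /forall2NP nr.
have psir x : O x -> psi x <> r by move=> Ox; case: (nr x).
pose D : set G := [set x | exists y, [/\ O y, x <= y & psi y < r]].
pose E : set G := [set x | exists y, [/\ O y, y <= x & r < psi y]].
have O0 : O (0 : G) := ltW (value_set_lt0 gamma).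
have DE x y : D x -> E y -> x < y.
  move=> [x' [Ox' xx' x'r]] [y' [Oy' y'y ry']].
  apply: le_lt_trans xx' (lt_le_trans _ y'y).
  by apply: (component_map_lt psiP Ox' Oy'); apply: lt_trans x'r ry'.
have low n : exists x, O x /\ r - n.+1%:R^-1 < psi x < r.
  have [|x Ox xP] := @component_map_dense (r - n.+1%:R^-1) r; last by exists x.
  by rewrite ltrBlDr ltrDl invr_gt0 ltr0Sn.
have upp n : exists x, O x /\ r < psi x < r + n.+1%:R^-1.
  have [|x Ox xP] := @component_map_dense r (r + n.+1%:R^-1); last by exists x.
  by rewrite ltrDl invr_gt0 ltr0Sn.
have {low}[u uP] := choice low; have {upp}[w wP] := choice upp.
have Du n : D (u n) by have [Ou /andP[_ ur]] := uP n; exists (u n).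
have Ew n : E (w n) by have [Ow /andP[rw _]] := wP n; exists (w n).
have ucof x : D x -> exists n, x < u n.
  move=> [y [Oy xy yr]]; have /inv_succ_lt[n nP] : 0 < r - psi y by rewrite subr_gt0.
  exists n; apply: le_lt_trans xy _; have [Ou /andP[ru _]] := uP n.
  apply: (component_map_lt psiP Oy Ou).
  by move: nP ru; move: (n.+1%:R^-1) => e; lra.
have wcof x : E x -> exists n, w n < x.
  move=> [y [Oy xy yr]]; have /inv_succ_lt[n nP] : 0 < psi y - r by rewrite subr_gt0.
  exists n; apply: lt_le_trans xy; have [Ow /andP[_ rw]] := wP n.
  apply: (component_map_lt psiP Ow Oy).
  by move: nP rw; move: (n.+1%:R^-1) => e; lra.
have cutDE : is_cut D E.
  apply: is_cutI => //; [by exists (u 0%N)|by exists (w 0%N)|move=> x].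
  have [Ox|nOx] := boolP (O x).
    have [xr|rx|/psir//] := ltgtP (psi x) r; first by left; exists x.
    by right; exists x.
  (* Elements of value below [gamma] lie beyond everything of value at least [gamma], so their sign
     decides the side. *)
  have far y : O y -> (natval x < natval y)%O.
    by apply: lt_le_trans; rewrite ltNge.
  have [x0|/ltW x0] := leP (0 : G) x.
    right; exists (w 0%N); have [Ow /andP[rw _]] := wP 0%N; split=> //.
    by rewrite ltW // natval_lt_lt // far.
  left; exists (u 0%N); have [Ou /andP[_ ur]] := uP 0%N; split=> //.
  rewrite -oz_leN2 ltW // natval_lt_lt ?oz_oppr_ge0 //.
  by rewrite !natvalN far.
have [K [L [DK EL []]]] := Gsym cutDE.
apply: (@countable_cofinality_eq _ _ G G^d D E) => //.
- by exists (u 0%N).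
- by move=> x /ucof[n]; exists (u n).
- by apply: (countable_cofinality_seq Du) => x /ucof[n /ltW]; exists n.
- by exists (w 0%N).
- by move=> x /wcof[n]; exists (w n).
- by apply: (@countable_cofinality_seq _ G^d _ w Ew) => x /wcof[n /ltW]; exists n.
Qed.

End Component.

Lemma symmetrically_complete_spherical : spherically_complete G.
Proof.
move=> C [B0 CB0] Cball Ctot; apply: contrapT => /set0P/negP/negPn/eqP Cempty.
have avoid g : exists2 B, C B & ~ B g.
  apply: contrapT => /forall2NP nB; suff : (\bigcap_(B in C) B) g by rewrite Cempty.
  by move=> B CB; apply: contrapT => nBg; case: (nB B).
have center B : C B -> exists a, B a.
  move=> /Cball[a [b ->]]; exists a.
  by rewrite /ultraball /= subrr natval_le0.
(* Balls are closed under the point reflection sending [y] to [x + (x - y)]. *)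
have reflect B x y : C B -> B x -> B y -> B (x + (x - y)).
  move=> /Cball[a [b ->]]; rewrite /ultraball /= => ax ay.
  rewrite opprD addrA natvalD //.
  by rewrite opprB -(subrKA a y (- x)) natvalD // (natvalB y a).
have convex B x y z : C B -> B x -> B z -> x <= y -> y <= z -> B y.
  move=> /Cball[a [b ->]]; rewrite /ultraball /= => ax az xy yz.
  by apply: (natval_between _ _ az ax); rewrite oz_leB2l.
have side B g : C B -> ~ B g -> (forall x, B x -> g < x) \/ (forall x, B x -> x < g).
  move=> CB nBg; apply: contrapT => /not_orP[/existsNP[x /not_implyP[Bx /negP]]].
  rewrite -leNgt => xg /existsNP[y /not_implyP[By /negP]]; rewrite -leNgt => gy.
  exact/nBg/(convex _ _ _ _ CB Bx By).
pose D : set G := [set g | exists2 B, C B & forall x, B x -> g < x].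
pose E : set G := [set g | exists2 B, C B & forall x, B x -> x < g].
(* A smaller ball [B'] of the nest avoids [a]. The point [a] and its reflection in some [c] of [B']
   then lie in [B] on opposite sides of [B']. *)
have both B : C B -> (exists2 g, D g & B g) /\ (exists2 g, E g & B g).
  move=> CB; have [a Ba] := center _ CB.
  have [B' CB' nB'a] := avoid a; have [c B'c] := center _ CB'.
  have B'B : B' `<=` B by have [/(_ _ Ba)|] := Ctot _ _ CB CB'.
  have Bac : B (c + (c - a)) by apply: reflect => //; apply: B'B.
  have nB'ac : ~ B' (c + (c - a)).
    by move=> /(reflect _ _ _ CB' B'c); rewrite [- (c + _)]opprD addNKr subKr.
  have [lt|lt] := side _ _ CB' nB'a.
    split; [by exists a => //; exists B'|exists (c + (c - a)) => //; exists B' => //].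
    have [/(_ _ B'c)|//] := side _ _ CB' nB'ac.
    by rewrite -{3}[c]addr0 oz_ltD2l ltNge oz_subr_ge0 ltW ?lt.
  split; [exists (c + (c - a)) => //; exists B' => //|by exists a => //; exists B'].
  have [//|/(_ _ B'c)] := side _ _ CB' nB'ac.
  by rewrite oz_ltDl oz_subr_gt0 ltNge ltW ?lt.
have cutDE : is_cut D E.
  apply: is_cutI; [by have [[g Dg _] _] := both _ CB0; exists g| | |].
  - by have [_ [g Eg _]] := both _ CB0; exists g.
  - move=> g; have [B CB /(side _ _ CB)[]] := avoid g; first by left; exists B.
    by right; exists B.
  move=> x y [B CB xB] [B' CB' B'y].
  have [BB'|B'B] := Ctot _ _ CB CB'.
    by have [a Ba] := center _ CB; apply: lt_trans (xB _ Ba) (B'y _ (BB' _ Ba)).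
  by have [a Ba] := center _ CB'; apply: lt_trans (xB _ (B'B _ Ba)) (B'y _ Ba).
have [K [L [DK EL []]]] := Gsym cutDE.
(* Each [g] of [D] is sent to a point of [E] inside a ball lying above [g]. Once [g] enters a given
   ball [B], the ball chosen for any larger element of [D] is contained in [B], which gives
   convergence. *)
have /choice[f fP] : forall g, exists e, D g -> E e /\
    exists B, [/\ C B, B e & forall x, B x -> g < x].
  move=> g; have [[B CB gB]|] := pselect (D g); last by exists 0.
  by have [_ [e Ee Be]] := both _ CB; exists e => _; split=> //; exists B.
apply: (@convergent_map_eq _ _ G G^d D E f K L) => //.
  split=> [g /fP[]//|e [B CB Be]]; have [[g Dg Bg] _] := both _ CB.
  exists g => // z /fP[_ [B' [CB' B'f zB']]] gz; rewrite leEdual ltW // Be //.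
  have [|] := Ctot _ _ CB CB'; last exact.
  by move=> /(_ _ Bg)/zB'; rewrite ltNge gz.
by move=> e [B CB Be]; have [_ [g Eg Bg]] := both _ CB; exists g; rewrite // ltEdual Be.
Qed.

End SymmetricallyComplete.

(** * Transfer of asymmetry from the group to its value set *)

Lemma is_cut_lower_upper (G : oZmodType) (c : G) (I J : set (value_set G)) :
  is_cut I J -> is_cut (lower_part c J) (upper_part c I).
Proof.
move=> [I0 J0 IJ lt]; apply: is_cutI; first exact: lower_part_neq0.
- exact: upper_part_neq0.
- move=> g; have [gc|cg] := leP g c; first by left; left.
  have [|delta dE] := @natval_pos_value_set _ (g - c); first by rewrite oz_subr_gt0.
  have : (I `|` J) delta by rewrite IJ.
  by case=> h; [right; split=> //|left; right]; exists delta; rewrite // dE.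
move=> x y [xc|[gamma Jg xg]] [cy [delta Id dy]]; first exact: le_lt_trans xc cy.
rewrite -(oz_ltD2r (- c)); apply: natval_lt_lt; first by rewrite oz_subr_ge0 ltW.
apply: le_lt_trans dy (lt_le_trans _ xg).
by rewrite -value_set_lt lt.
Qed.

Lemma symmetrically_complete_value_set (G : oZmodType) :
  symmetrically_complete G -> (forall gamma : value_set G, dense_component gamma) ->
  strongly_symmetrically_complete (value_set G).
Proof.
move=> Gsym dense I J IJ; have [I0 J0 _ _] := IJ.
apply/(asymmetric_lower_upper dense 0 I0 J0).
exact/Gsym/is_cut_lower_upper.
Qed.

(** * Constructing symmetrically complete groups *)

Section Reflection.
Variable G : oZmodType.
Implicit Types D E K L : set G.

Definition opp_set D : set G := [set x | D (- x)].

Lemma opp_setK D : opp_set (opp_set D) = D.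
Proof. by apply/seteqP; split=> x; rewrite /opp_set /= opprK. Qed.

Lemma card_opp_set D : opp_set D #= D.
Proof.
have -> : opp_set D = -%R @` D.
  apply/seteqP; split=> [x Dx|_ [x Dx <-]]; first by exists (- x); rewrite ?opprK.
  by rewrite /opp_set /= opprK.
by apply: inj_card_eq => x y _ _; exact: oppr_inj.
Qed.

Lemma cofinal_opp_set D K :
  cofinal_in (T := G^d) (opp_set D) (opp_set K) <-> cofinal_in (T := G) D K.
Proof.
split=> -[KD Kcof]; split=> [x Kx|x Dx].
- by have := KD (- x); rewrite /opp_set /= opprK; apply.
- have [|y Ky] := Kcof (- x); first by rewrite /opp_set /= opprK.
  by rewrite leEdual => yx; exists (- y) => //; rewrite -oz_leN2 opprK.
- exact: KD.
- have [y Ky xy] := Kcof _ Dx; exists (- y); first by rewrite /opp_set /= opprK.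
  by rewrite leEdual -oz_leN2 opprK.
Qed.

Lemma has_cofinality_opp_set D K :
  has_coinitiality (opp_set D) (opp_set K) <-> has_cofinality D K.
Proof.
rewrite /has_coinitiality /has_cofinality cofinal_opp_set.
split=> -[DK Kmin]; split=> // L DL.
  have /Kmin : cofinal_in (T := G^d) (opp_set D) (opp_set L) by apply/cofinal_opp_set.
  move=> h; apply: card_le_trans (card_le_trans h _).
    by have := card_opp_set K; rewrite card_eq_le => /andP[].
  by have := card_opp_set L; rewrite card_eq_le => /andP[].
have /Kmin : cofinal_in D (opp_set L) by apply/cofinal_opp_set; rewrite opp_setK.
move=> h; apply: card_le_trans (card_le_trans h _).
  by have := card_opp_set K; rewrite card_eq_le => /andP[].
by have := card_opp_set L; rewrite card_eq_le => /andP[].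
Qed.

Lemma uncountable_cofinality_opp_set D :
  uncountable_coinitiality (opp_set D) <-> uncountable_cofinality D.
Proof.
have [K DK] := cofinality_exists D.
rewrite (has_cofinality_uncountable DK) /uncountable_coinitiality.
have /has_cofinality_uncountable -> :=
  (has_cofinality_opp_set D K).2 DK.
by rewrite (eq_countable (card_opp_set K)).
Qed.

Lemma is_cut_opp_set D E : is_cut D E -> is_cut (opp_set E) (opp_set D).
Proof.
move=> [[x Dx] [y Ey] DE lt]; apply: is_cutI.
- by exists (- y); rewrite /opp_set /= opprK.
- by exists (- x); rewrite /opp_set /= opprK.
- move=> z; have : (D `|` E) (- z) by rewrite DE.
  by case=> ?; [right|left].
by move=> u v Eu Dv; rewrite -oz_ltN2 lt.
Qed.

(** Negation exchanges the sides of a cut together with their cofinalities, so only centers in the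
    lower side need a direct argument. *)
Lemma asymmetric_cut_opp_set D E :
  asymmetric_cut (opp_set E) (opp_set D) -> asymmetric_cut D E.
Proof.
have [K DK] := cofinality_exists D.
have [L EL] := @cofinality_exists _ G^d E.
have EL' : has_cofinality (opp_set E) (opp_set L).
  by apply/has_cofinality_opp_set; rewrite !opp_setK.
have DK' := (has_cofinality_opp_set D K).2 DK.
rewrite (asymmetric_cutP EL' DK') (asymmetric_cutP DK EL); apply: contra_not => eq.
apply: card_eq_trans (card_opp_set L) (card_eq_trans _ _).
  by rewrite card_eq_sym; exact: eq.
by rewrite card_eq_sym; exact: card_opp_set.
Qed.

End Reflection.

(** * Uncountable cofinalities of the group read off from the value set *)

Section ValueSetCofinality.
Variable G : oZmodType.
Hypothesis dense : forall gamma : value_set G, dense_component gamma.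
Hypothesis vG0 : [set: value_set G] !=set0.

Lemma uncountable_max_aleph0 {T1 T2 : Type} (K : set T1) (L : set T2) :
  (infinite_set L -> K #= L) -> (countable L -> countable K) ->
  ~ countable K <-> ~ countable L.
Proof.
move=> infL cL; split; first exact: contra_not.
move=> uL cK; have infL' : infinite_set L by move=> /finite_set_countable.
by apply: uL; rewrite -(eq_countable (infL infL')).
Qed.

(** The elements above [c] form the upper side induced by the whole value set, so their coinitiality
    is the cofinality of [vG] or aleph-zero, whichever is larger. *)
Lemma uncountable_coinitiality_gt (c : G) :
  uncountable_coinitiality [set g : G | c < g] <->
  uncountable_cofinality [set: value_set G].
Proof.
have -> : [set g : G | c < g] = upper_part c setT.
  apply/seteqP; split=> [g cg|g []//]; split=> //.
  have [|delta <-] := @natval_pos_value_set _ (g - c); last by exists delta.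
  by rewrite oz_subr_gt0.
have [L vL] := cofinality_exists [set: value_set G].
have [K QK] := @cofinality_exists _ G^d (upper_part c setT).
have [_ infL cL] := upper_part_coinitiality dense vG0 vL QK.
rewrite (has_cofinality_uncountable vL) /uncountable_coinitiality.
rewrite (has_cofinality_uncountable QK).
exact: uncountable_max_aleph0.
Qed.

Lemma uncountable_cofinality_setT :
  uncountable_cofinality [set: G] <-> uncountable_coinitiality [set: value_set G].
Proof.
have -> : [set: G] = lower_part 0 setT.
  apply/seteqP; split=> // g _; have [g0|g0] := leP g (0 : G); first by left.
  by right; have [delta dE] := natval_pos_value_set g0; exists delta; rewrite // subr0 dE.
have [L vL] := @cofinality_exists _ (value_set G)^d [set: value_set G].
have [K PK] := cofinality_exists (lower_part (0 : G) setT).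
have [_ infL cL] := lower_part_cofinality vG0 vL PK.
rewrite (has_cofinality_uncountable PK) /uncountable_coinitiality.
rewrite (has_cofinality_uncountable vL).
exact: uncountable_max_aleph0.
Qed.

(** The negation image of the whole group is convertible to the whole group. *)
Lemma uncountable_coinitiality_setT :
  uncountable_coinitiality [set: G] <-> uncountable_cofinality [set: G].
Proof. exact: (uncountable_cofinality_opp_set [set: G]). Qed.

Lemma strongly_symmetrically_completeP :
  strongly_symmetrically_complete G <->
  symmetrically_complete G /\ uncountable_cofinality [set: value_set G].
Proof.
split=> [Gstrong|[Gsym unc] D E DE].
  split=> [D E /Gstrong[]//|].
  (* The left side of this cut has maximum 0, so strong asymmetry makes the coinitiality of the
     positive elements uncountable. *)
  have cut0 : is_cut [set g : G | g <= 0] [set g : G | 0 < g].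
    apply: is_cutI; first by exists 0 => /=.
    - have [gamma _] := vG0; have [a a0 _] := value_set_posrep gamma.
      by exists a.
    - by move=> x; have [x0|x0] := leP x (0 : G); [left|right].
    by move=> x y /= x0; apply: le_lt_trans.
  have [_ [|/uncountable_coinitiality_gt//]] := Gstrong _ _ cut0.
  have [K DK] := cofinality_exists [set g : G | g <= 0].
  move/(has_cofinality_uncountable DK); case; apply: finite_set_countable.
  exact: (has_cofinality_max (m := 0 : G) DK (lexx _)).
split; first exact: Gsym.
(* Suppose both cofinalities are countable. An extremum on either side would make the other one
   uncountable, so neither side has one; both cofinalities are then aleph-zero, against symmetric
   completeness. *)
apply: contrapT => /not_orP[/uncountable_cofinalityP/contrapT cD].
move=> /(@uncountable_cofinalityP _ G^d)/contrapT cE.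
have [D0 E0 DET lt] := DE.
have DorE x : D x \/ E x by have : (D `|` E) x by rewrite DET.
have Dmax : no_max D.
  apply: contrapT => /no_maxPn[m Dm mP].
  have EE : E = [set g : G | m < g].
    apply/seteqP; split=> [g Eg|g mg] /=; first exact: lt.
    by case: (DorE g) => // /mP; rewrite leNgt mg.
  have /(@uncountable_cofinalityP _ G^d) : uncountable_coinitiality E.
    by rewrite EE; apply/uncountable_coinitiality_gt.
  exact.
have Emin : no_max (T := G^d) E.
  apply: contrapT => /no_maxPn[m Em mP].
  have DD : opp_set D = [set g : G | - m < g].
    apply/seteqP; split=> [g Dg|g mg] /=; first by rewrite -oz_ltN2 opprK lt.
    case: (DorE (- g)) => // /mP; rewrite leEdual leNgt -oz_ltN2 opprK.
    by rewrite [_ < _]mg.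
  have /uncountable_cofinalityP : uncountable_cofinality D.
    apply/uncountable_cofinality_opp_set; rewrite DD.
    exact/uncountable_coinitiality_gt.
  exact.
have [K [L [DK EL []]]] := Gsym _ _ DE.
exact: (@countable_cofinality_eq _ _ G G^d D E).
Qed.

(** The two ends of [vG] play different roles: its cofinality governs the neighbourhood of a point
    of [G], its coinitiality governs both ends of [G]. *)
Lemma extremely_symmetrically_completeP :
  extremely_symmetrically_complete G <->
  [/\ symmetrically_complete G, uncountable_cofinality [set: value_set G]
    & uncountable_coinitiality [set: value_set G]].
Proof.
have strong_iff := strongly_symmetrically_completeP.
have cof_iff := uncountable_cofinality_setT.
split=> [[/strong_iff[Gsym unc] _ /cof_iff]|[Gsym unc /cof_iff cofG]] //.
split=> //; first exact/strong_iff.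
exact/uncountable_coinitiality_setT.
Qed.

(** * Cuts with a center, and the existence of centers *)

Hypothesis vGstrong : strongly_symmetrically_complete (value_set G).

(** The hypothesis on [c] says that points of [D] above [c] are infinitely closer to it than points
    of [E]. Values thus separate the two sides, and the cut is the one induced at [c]. *)
Lemma asymmetric_centered_cut (D E : set G) (c : G) : is_cut D E -> D c ->
  (forall g e, D g -> E e -> c < g -> (natval (e - c) < natval (g - c)%R)%O) ->
  asymmetric_cut D E.
Proof.
move=> [D0 [e0 Ee0] DET lt] Dc cP.
have DorE x : D x \/ E x by have : (D `|` E) x by rewrite DET.
pose J : set (value_set G) :=
  [set delta | forall e, E e -> (natval (e - c)%R < value_val delta)%O].
have value g : c < g -> exists delta, value_val delta = natval (g - c).
  by move=> cg; apply: natval_pos_value_set; rewrite oz_subr_gt0.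
have DE : D = lower_part c J.
  apply/seteqP; split=> g.
    move=> Dg; have [gc|cg] := leP g c; [by left|right].
    have [delta dE] := value _ cg; exists delta; last by rewrite dE.
    by move=> e Ee; rewrite dE cP.
  case: (DorE g) => // Eg [gc|[delta Jd dg]].
    by have := lt _ _ Dc Eg; rewrite ltNge gc.
  by have := lt_le_trans (Jd _ Eg) dg; rewrite ltxx.
have EE : E = upper_part c (~` J).
  apply/seteqP; split=> g.
    move=> Eg; have cg := lt _ _ Dc Eg; split=> //.
    have [delta dE] := value _ cg; exists delta; last by rewrite dE.
    by move=> /(_ _ Eg); rewrite dE ltxx.
  move=> [cg [delta nJd gd]]; case: (DorE g) => // Dg.
  case: nJd => e Ee; exact: lt_le_trans (cP _ _ Dg Ee cg) gd.
have I0 : ~` J !=set0.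
  have : upper_part c (~` J) e0 by rewrite -EE.
  by move=> [_ [delta Id _]]; exists delta.
(* Empty [J] means that no point of [D] lies above [c]; there is no cut of [vG] to appeal to. *)
rewrite DE EE; have [J0|/set0P J0] := eqVneq J set0.
  exact: asymmetric_lower_upper0.
apply/(asymmetric_lower_upper dense c I0 J0)/vGstrong.
apply: is_cutI => // [delta|delta eps /existsNP[e /not_implyP[Ee /negP]]].
  by have [Jd|nJd] := pselect (J delta); [right|left].
by rewrite -leNgt value_set_lt => delta_le /(_ _ Ee); exact: le_lt_trans.
Qed.

Lemma asymmetric_cocentered_cut (D E : set G) (c : G) : is_cut D E -> E c ->
  (forall d g, D d -> E g -> g < c -> (natval (c - d) < natval (c - g)%R)%O) ->
  asymmetric_cut D E.
Proof.
move=> DE Ec cP; apply: asymmetric_cut_opp_set.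
apply: (@asymmetric_centered_cut _ _ (- c)); first exact: is_cut_opp_set.
  by rewrite /opp_set /= opprK.
move=> g e Eg De cg; have := cP _ _ De Eg.
rewrite !opprK -oz_ltN2 opprK => /(_ cg).
by rewrite [c + e]addrC [c + g]addrC.
Qed.

Lemma cut_center (R : realType) (D E : set G) :
  spherically_complete G ->
  (forall gamma, exists2 psi : G -> R,
    component_map gamma psi & component_onto gamma psi) ->
  is_cut D E ->
  (exists2 c, D c &
     forall g e, D g -> E e -> c < g -> (natval (e - c) < natval (g - c)%R)%O) \/
  (exists2 c, E c &
     forall d g, D d -> E g -> g < c -> (natval (c - d) < natval (c - g)%R)%O).
Proof.
move=> sph real [[d0 Dd0] [e0 Ee0] DET lt].
have DorE x : D x \/ E x by have : (D `|` E) x by rewrite DET.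
have [[d1 [e1 [Dd1 Ee1 maxP]]]|nomax] := pselect (exists d1 e1, [/\ D d1, E e1
    & forall d e, D d -> E e -> (natval (e - d)%R <= natval (e1 - d1)%R)%O]).
  have [|gamma gE] := @natval_pos_value_set _ (e1 - d1).
    by rewrite oz_subr_gt0 lt.
  rewrite -gE in maxP.
  have [psi psiP onto] := real gamma.
  pose S := [set psi (d - d1) | d in [set d | D d /\
    (value_val gamma <= natval (d - d1)%R)%O]].
  have O0 : (value_val gamma <= natval (0 : G))%O := ltW (value_set_lt0 gamma).
  have Sub e : E e -> (value_val gamma <= natval (e - d1)%R)%O ->
      ubound S (psi (e - d1)).
    move=> Ee Oe _ [d [Dd Od] <-]; apply: (component_map_le psiP Od Oe).
    by rewrite oz_leD2r ltW // lt.
  have S0 : S !=set0 by exists (psi (d1 - d1)); exists d1; rewrite //= subrr.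
  have Oe1 : (value_val gamma <= natval (e1 - d1)%R)%O by rewrite gE.
  (* The center realizes the supremum of the images of [D] relative to [d1]. A point on the same
     side lying beyond it has the same image, so it differs from [c] by a value above [gamma]. *)
  have [x Ox xS] := onto (sup S); set c := d1 + x.
  have cd1 : c - d1 = x by rewrite /c addrC addKr.
  have gc g : g - d1 - x = g - c by rewrite /c opprD addrA.
  case: (DorE c) => [Dc|Ec]; [left|right]; exists c => //.
    move=> g e Dg Ee cg; apply: le_lt_trans (maxP _ _ Dc Ee) _.
    have xg : x <= g - d1 by rewrite -cd1 oz_leD2r ltW.
    have Og : (value_val gamma <= natval (g - d1)%R)%O.
      apply: (natval_between xg _ Ox Oe1); rewrite oz_leD2r ltW //; exact: lt.
    rewrite -gc; apply: (component_map_eq psiP) => //; apply/eqP; rewrite eq_le.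
    rewrite (component_map_le psiP Ox Og xg) andbT xS.
    by apply: ub_le_sup; [exists (psi (e1 - d1)); exact: Sub|exists g].
  move=> d g Dd Eg gc'; apply: le_lt_trans (maxP _ _ Dd Ec) _.
  have xg : g - d1 <= x by rewrite -cd1 oz_leD2r ltW.
  have Og : (value_val gamma <= natval (g - d1)%R)%O.
    by apply: (natval_between _ xg O0 Ox); rewrite oz_subr_ge0 ltW // lt.
  rewrite natvalB -gc; apply: (component_map_eq psiP) => //; apply/eqP; rewrite eq_le.
  by rewrite (component_map_le psiP Og Ox xg) xS /=; apply: ge_sup => //; exact: Sub.
have larger d e : D d -> E e -> exists d' e', [/\ D d', E e'
    & (natval (e - d) < natval (e' - d')%R)%O].
  move=> Dd Ee; apply: contrapT => nlarger; apply: nomax.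
  exists d, e; split=> // d' e' Dd' Ee'.
  rewrite leNgt; apply/negP => h; apply: nlarger; by exists d', e'.
pose C : set (set G) := [set B | exists d e, [/\ D d, E e & B = ultraball d e]].
(* The larger value gives the smaller ball. The centers are close enough because [d'] lies between
   [d] and [e], or else [d] lies between [d'] and [e']. *)
have sub d e d' e' : D d -> E e -> D d' -> E e' ->
    (natval (d - e) <= natval (d' - e')%R)%O -> ultraball d' e' `<=` ultraball d e.
  move=> Dd Ee Dd' Ee' vv g; rewrite /ultraball /= => vg.
  rewrite -(subrKA d' d (- g)) natvalD //; last exact: le_trans vg.
  have O0 : (natval (d - e) <= natval (0 : G))%O := natval_le0 _.
  have [dd'|/ltW d'd] := leP d d'.
    rewrite [natval (d - d')]natvalB.
    apply: (natval_between _ _ O0 (_ : _ <= natval (e - d)%R)%O).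
    - by rewrite oz_subr_ge0.
    - by rewrite oz_leD2r ltW // lt.
    - by rewrite natvalB.
  apply: (natval_between _ _ O0 (_ : _ <= natval (e' - d')%R)%O).
  - by rewrite oz_subr_ge0.
  - by rewrite oz_leD2r ltW // lt.
  - by rewrite [natval (e' - _)]natvalB.
have [||_ _ [d [e [Dd Ee ->]]] [d' [e' [Dd' Ee' ->]]]|c cP] := sph C.
- by exists (ultraball d0 e0), d0, e0.
- by move=> B [d [e [_ _ ->]]]; exists d, e.
- by case/orP: (le_total (natval (d - e)) (natval (d' - e'))) => /sub h;
    [right|left]; apply: h.
have cball d e : D d -> E e -> (natval (e - d) <= natval (c - d)%R)%O.
  move=> Dd Ee; have : ultraball d e c by apply: cP; exists d, e.
  by rewrite /ultraball /= natvalB [natval (d - c)]natvalB.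
have cball' d e : D d -> E e -> (natval (e - d) <= natval (e - c)%R)%O.
  by move=> Dd Ee; rewrite -(subrKA d e (- c)) natvalD // [natval (d - c)]natvalB cball.
case: (DorE c) => [Dc|Ec]; [left|right]; exists c => //.
  (* A pair with distance of still larger value gives [e'] closer to [c] than [g] is, hence an
     element of [E] below [g] in [D]. *)
  move=> g e Dg Ee cg; rewrite ltNge; apply/negP => ge.
  have [d' [e' [Dd' Ee' big]]] := larger _ _ Dc Ee.
  have : e' - c < g - c.
    apply: natval_lt_lt; first by rewrite oz_subr_ge0 ltW.
    exact: le_lt_trans ge (lt_le_trans big (cball' _ _ Dd' Ee')).
  by rewrite oz_ltD2r ltNge ltW // lt.
move=> d g Dd Eg gc; rewrite ltNge; apply/negP => ge.
have [d' [e' [Dd' Ee' big]]] := larger _ _ Dd Ec.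
have : c - d' < c - g.
  apply: natval_lt_lt; first by rewrite oz_subr_ge0 ltW.
  exact: le_lt_trans ge (lt_le_trans big (cball _ _ Dd' Ee')).
by rewrite oz_ltB2l ltNge ltW // lt.
Qed.

End ValueSetCofinality.

(** * The three characterizations *)

Lemma symmetrically_completeP (R : realType) (G : oZmodType) :
  symmetrically_complete G <->
  [/\ spherically_complete G, strongly_symmetrically_complete (value_set G)
    & forall gamma : value_set G, ordered_group_isomorphic (arch_component gamma) R].
Proof.
split=> [Gsym|[sph vGstrong iso] D E DE].
  have real (gamma : value_set G) : exists psi : G -> R,
      [/\ component_map gamma psi, component_onto gamma psi
        & ordered_group_isomorphic (arch_component gamma) R].
    have [psi [psiP psi_iso]] := component_map_exists R gamma.
    have onto := symmetrically_complete_component Gsym psiP.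
    by exists psi; split=> //; apply: psi_iso.
  split; first exact: symmetrically_complete_spherical.
    apply: symmetrically_complete_value_set => // gamma.
    by have [psi [psiP onto _]] := real gamma; exact: component_onto_dense psiP onto.
  by move=> gamma; have [psi []] := real gamma.
have real gamma := isomorphic_component_map (iso gamma).
have dense (gamma : value_set G) : dense_component gamma.
  by have [psi psiP onto] := real gamma; exact: component_onto_dense psiP onto.
have [[c Dc cP]|[c Ec cP]] := cut_center sph real DE.
  by apply: (asymmetric_centered_cut dense vGstrong DE Dc).
by apply: (asymmetric_cocentered_cut dense vGstrong DE Ec).
Qed.

Theorem theorem4 (R : realType) (G : oZmodType)
    (G_nontrivial : exists a : G, a != 0) :
  [/\ symmetrically_complete G <->
        [/\ spherically_complete G,
            strongly_symmetrically_complete (value_set G)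
          & forall gamma : value_set G,
              ordered_group_isomorphic (arch_component gamma) R],
      strongly_symmetrically_complete G <->
        [/\ spherically_complete G,
            strongly_symmetrically_complete (value_set G),
            (forall gamma : value_set G,
              ordered_group_isomorphic (arch_component gamma) R)
          & uncountable_cofinality [set: value_set G]]
    & extremely_symmetrically_complete G <->
        [/\ spherically_complete G,
            strongly_symmetrically_complete (value_set G),
            (forall gamma : value_set G,
              ordered_group_isomorphic (arch_component gamma) R)
          & extremely_symmetrically_complete (value_set G)]].
Proof.
have vG0 : [set: value_set G] !=set0.
  by have [a a0] := G_nontrivial; have [gamma _] := natval_value_set a0; exists gamma.
(* The component condition of the first equivalence supplies the density assumed by the lemmas
   behind the other two. *)
have dense : symmetrically_complete G ->
    forall gamma : value_set G, dense_component gamma.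
  move=> /(symmetrically_completeP R)[_ _ iso] gamma.
  have [psi psiP onto] := isomorphic_component_map (iso gamma).
  exact: component_onto_dense psiP onto.
have strong_sym : strongly_symmetrically_complete G -> symmetrically_complete G.
  by move=> Gstrong D E /Gstrong[].
split; first exact: symmetrically_completeP.
  split=> [Gstrong|[sph vGstrong iso unc]].
    have Gsym := strong_sym Gstrong.
    have [sph vGstrong iso] := (symmetrically_completeP R G).1 Gsym.
    by split=> //; have [] := (strongly_symmetrically_completeP (dense Gsym) vG0).1 Gstrong.
  have Gsym : symmetrically_complete G by apply/(symmetrically_completeP R).
  exact/(strongly_symmetrically_completeP (dense Gsym) vG0).
split=> [Gextr|[sph vGstrong iso [_ uncoin uncof]]].
  have [/strong_sym Gsym _ _] := Gextr.
  have [sph vGstrong iso] := (symmetrically_completeP R G).1 Gsym.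
  have [] := (extremely_symmetrically_completeP (dense Gsym) vG0).1 Gextr.
  by split.
have Gsym : symmetrically_complete G by apply/(symmetrically_completeP R).
exact/(extremely_symmetrically_completeP (dense Gsym) vG0).
Qed.
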